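(* Let $G\in H^\infty_{m\times p}$ and assume that $T_GT_G^*$ is strictly positive. Let $\Theta(z)=Y(z)\Theta_0$, $z\in\mathbb{D}$, where $\Theta_0$ and $Y$ are associated with $G$ as defined in the context. Then $\Theta$ belongs to $H^\infty_{p\times(p-m)}$ and is an inner function with $\operatorname{Im} T_\Theta=\operatorname{Ker} T_G$.
   Context: $\mathbb{D}$ is the open unit disc, $\mathbb{T}$ the unit circle. $H^\infty_{r\times s}$ is the space of $r\times s$ matrices with entries in $H^\infty$ of $\mathbb{D}$. $\ell^2_+(\mathbb{C}^n)$ is the space of square summable sequences in $\mathbb{C}^n$ indexed by $0,1,2,\ldots$ For $F\in H^\infty_{r\times s}$ with Taylor coefficients $F_0,F_1,\ldots$ at zero, $T_F:\ell^2_+(\mathbb{C}^s)\to\ell^2_+(\mathbb{C}^r)$ is the analytic Toeplitz operator whose $(i,j)$ block entry ($i,j\ge0$) is $F_{i-j}$ if $i\ge j$ and $0$ otherwise, and $H_F:\ell^2_+(\mathbb{C}^s)\to\ell^2_+(\mathbb{C}^r)$ is the Hankel operator whose $(i,j)$ block entry is $F_{i+j+1}$. A selfadjoint operator is strictly positive if it is $\ge\delta I$ for some $\delta>0$. $F$ is inner if $T_F$ is an isometry (equivalently, $F(\zeta)^*F(\zeta)=I$ for a.e. $\zeta\in\mathbb{T}$). $S_n$ is the block forward shift on $\ell^2_+(\mathbb{C}^n)$, and $E_n=\begin{bmatrix}I_n&0&0&\cdots\end{bmatrix}^\top:\mathbb{C}^n\to\ell^2_+(\mathbb{C}^n)$ is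 the embedding onto the first coordinate space. For $G\in H^\infty_{m\times p}$ with $T_GT_G^*$ strictly positive define: - $\Theta_0$, a $p\times k$ matrix with $\Theta_0\Theta_0^*=I_p-E_p^*T_G^*(T_GT_G^* )^{-1}T_GE_p$ and $\operatorname{Ker}\Theta_0=\{0\}$ (so $k$ is the rank of the right hand side; $\Theta_0$ is determined up to right multiplication by a unitary matrix, and any fixed choice is allowed); - $Y(z)=I_p-zE_p^*(I-zS_p^* )^{-1}T_G^*(T_GT_G^* )^{-1}H_GE_p$ for $z\in\mathbb{D}$, a $p\times p$ matrix function. *)

(* Defs.v *)
From HB Require Import structures.
From mathcomp Require Import all_boot all_order all_algebra.
From mathcomp Require Import all_classical all_reals all_analysis.
From mathcomp Require Import complex.

Set Implicit Arguments.
Unset Strict Implicit.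
Unset Printing Implicit Defensive.

Import Order.TTheory GRing.Theory Num.Theory.
Import numFieldNormedType.Exports.

Local Open Scope classical_set_scope.
Local Open Scope ring_scope.
Local Open Scope sesquilinear_scope.

(* The complex numbers over R.  Naming the structure, rather than writing R[i],
   lets the topology induced by the modulus be inferred. *)
Definition cplx (R : realType) : numClosedFieldType := R[i].

(* A vector space together with the subset of its vectors that form the inner
   product space under study and the inner product on that subset, linear in
   the first argument.  For ell^2 the ambient space is the space of all
   sequences, so that operators can be given by formulas on sequences; every
   notion below only tests vectors of the subset. *)
Record hspace (R : realType) := HSpace {
  hcar :> lmodType (cplx R);
  hmem : set hcar;
  hdot : hcar -> hcar -> cplx R }.
Arguments hmem {R} h _.
Arguments hdot {R h} _ _.

Section operators.
Context {R : realType}.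
Implicit Types U V : hspace R.

(* [hadj T y] is the vector x such that <T u, y> = <u, x> for all u. *)
Definition hadj U V (T : U -> V) (y : V) : U :=
  xget 0 [set x | hmem U x /\ forall u, hmem U u -> hdot (T u) y = hdot u x].

(* [hinv T y] is the vector x such that T x = y. *)
Definition hinv U V (T : U -> V) (y : V) : U :=
  xget 0 [set x | hmem U x /\ T x = y].

Definition selfadjoint U (A : U -> U) : Prop :=
  (forall x, hmem U x -> hmem U (A x)) /\
  (forall x y, hmem U x -> hmem U y -> hdot (A x) y = hdot x (A y)).

(* In the order of [cplx R], 0 < delta forces delta to be real. *)
Definition strictly_positive U (A : U -> U) : Prop :=
  selfadjoint A /\
  exists2 delta : cplx R, 0 < delta &
    forall x, hmem U x -> delta * hdot x x <= hdot (A x) x.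

Definition isometry U V (T : U -> V) : Prop :=
  forall x, hmem U x -> hmem V (T x) /\ hdot (T x) (T x) = hdot x x.

Definition hIm U V (T : U -> V) : set V := T @` hmem U.
Definition hKer U V (T : U -> V) : set U := [set x | hmem U x /\ T x = 0].

Definition dotc n (x y : 'cV[cplx R]_n) : cplx R := (y^t* *m x) 0 0.

Definition Cn n : hspace R := @HSpace R 'cV[cplx R]_n setT (@dotc n).

Definition ell2 n : hspace R :=
  @HSpace R (nat -> 'cV[cplx R]_n)
    [set x | cvgn (series (fun k => dotc (x k) (x k)))]
    (fun x y => limn (series (fun k => dotc (x k) (y k)))).

Definition mx_of_op m n (f : Cn n -> Cn m) : 'M[cplx R]_(m, n) :=
  \matrix_(i, j) (f (delta_mx j 0) : 'cV_m) i 0.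

Definition block_op r s (A : nat -> nat -> 'M[cplx R]_(r, s))
    (x : ell2 s) : ell2 r :=
  fun i => \col_k limn (series (fun j => (A i j *m x j) k 0)).

Definition block_shift n (x : ell2 n) : ell2 n :=
  fun k => if k is k'.+1 then x k' else 0.

Definition emb n (u : Cn n) : ell2 n := fun k => if k is 0%N then u else 0.

(* [f] is the sum on the open unit disc of the power series with coefficients
   [a].  Functions on the disc are represented by functions on [cplx R] whose
   values outside the disc are never used. *)
Definition disc_expansion (f : cplx R -> cplx R) (a : nat -> cplx R) : Prop :=
  forall z, `|z| < 1 -> series (fun n => a n * z ^+ n) @ \oo --> f z.

(* Bounded analytic functions on the disc; analytic means that the Taylor
   series at 0 converges to the function on the whole disc. *)
Definition Hinfty1 (f : cplx R -> cplx R) : Prop :=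
  (exists a, disc_expansion f a) /\
  (exists M : cplx R, forall z, `|z| < 1 -> `|f z| <= M).

Definition taylor1 (f : cplx R -> cplx R) : nat -> cplx R :=
  xget (fun=> 0) [set a | disc_expansion f a].

Definition Hinfty r s (F : cplx R -> 'M[cplx R]_(r, s)) : Prop :=
  forall i j, Hinfty1 (fun z => F z i j).

Definition taylor r s (F : cplx R -> 'M[cplx R]_(r, s)) (n : nat) :
    'M[cplx R]_(r, s) :=
  \matrix_(i, j) taylor1 (fun z => F z i j) n.

Definition toeplitz r s (F : cplx R -> 'M[cplx R]_(r, s)) : ell2 s -> ell2 r :=
  block_op (fun i j => if (j <= i)%N then taylor F (i - j) else 0).

Definition hankel r s (F : cplx R -> 'M[cplx R]_(r, s)) : ell2 s -> ell2 r :=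
  block_op (fun i j => taylor F (i + j).+1).

Definition inner r s (F : cplx R -> 'M[cplx R]_(r, s)) : Prop :=
  Hinfty F /\ isometry (toeplitz F).

Section associated.
Variables (m p : nat) (G : cplx R -> 'M[cplx R]_(m, p)).
Let TG : ell2 p -> ell2 m := toeplitz G.

Definition TTstar : ell2 m -> ell2 m := TG \o hadj TG.

Definition Theta0_gram : 'M[cplx R]_p :=
  1%:M - mx_of_op (hadj (@emb p) \o hadj TG \o hinv TTstar \o TG \o @emb p).

(* Ker Theta0 = {0} makes k the rank of [Theta0_gram G]. *)
Definition is_Theta0 k (Theta0 : 'M[cplx R]_(p, k)) : Prop :=
  Theta0 *m Theta0^t* = Theta0_gram /\
  (forall v : 'cV[cplx R]_k, Theta0 *m v = 0 -> v = 0).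

Definition Yfun (z : cplx R) : 'M[cplx R]_p :=
  1%:M - z *: mx_of_op
    (hadj (@emb p) \o hinv (fun x : ell2 p => x - z *: hadj (@block_shift p) x)
       \o hadj TG \o hinv TTstar \o hankel G \o @emb p).

End associated.
End operators.

(* Main.v *)
From HB Require Import structures.
Require Import Defs.
From mathcomp Require Import all_boot all_order all_algebra.
From mathcomp Require Import all_classical all_reals all_analysis.
From mathcomp Require Import complex.
From mathcomp Require Import cyclic separable cyclotomic.
From mathcomp Require Import ring zify.

(** Write T for the Toeplitz operator of G, T' for its adjoint, S for the
    shift, E for the embedding onto the first coordinate, and K for Ker T.
    Since T commutes with S, the space K is invariant under S, and by the
    argument of Wold, Beurling and Lax it is the isometric image of a Toeplitz
    operator whose columns span the wandering space of K, the orthogonal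
    complement of S K in K.  The theorem says that the columns of Theta are
    an orthonormal basis of the wandering space.

    Put W = T' (T T')^-1 H E.  The coefficients of Y are I, -W_0, -W_1, ...,
    that is, the column sequence of Y at v is E v - S W v.  As T W = H E and
    T E v = E G_0 v + S H E v, it is mapped by T to E G_0 v (toep_Y); the
    range of W lies in the range of T', hence is orthogonal to K (W_orth_ker).
    Let P = I - T' (T T')^-1 T be the projection onto K, so that
    Theta0 Theta0^* = E' P E.  From T P = 0 one gets G_0 Theta0 = 0, so the
    columns of Theta lie in K, and they are orthogonal to S K.  Moreover
    Theta Theta0^* w = P E w (Theta_adjoint_P): both sides lie in K, have the
    same first coordinate and are orthogonal to S K.  Because Theta0^* is
    onto, inner products with columns of Theta reduce to inner products with
    P E w, which gives orthonormality and shows that the first coordinate of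
    a vector of K lies in the range of Theta0.

    These properties make the Toeplitz operator of Theta an isometry onto K
    (wandering_isometry, wandering_onto).  An isometric Toeplitz operator has
    a symbol bounded by 1 on the disc, by testing it on Szego kernels
    (isometry_sup_le1).  For the size of Theta: G_0 is onto since T is, and
    toep_Y shows that the kernel of G_0 consists of first coordinates of
    vectors of K, so it equals the range of the injective matrix Theta0.

    Three facts from analysis support this.  The Taylor coefficients of a
    bounded function are square summable (coef_sqr_sum_le), so that T E v and
    H E v are in ell^2.  A strictly positive operator is onto
    (strictly_positive_surj), which makes sense of (T T')^-1.  Finally
    (I - z S')^-1 y exists for z in the disc, and its first coordinate is the
    sum of the power series with coefficients y_n (resolvent).  The
    adjoint of T exists because T T' is strictly positive (hadjP). *)

Set Implicit Arguments.
Unset Strict Implicit.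
Unset Printing Implicit Defensive.

Import Order.TTheory GRing.Theory Num.Theory.
Import numFieldNormedType.Exports.

Local Open Scope classical_set_scope.
Local Open Scope ring_scope.
Local Open Scope sesquilinear_scope.

(** * Limits of complex sequences *)

Section complex_limits.
Context {R : realType}.
Local Notation C := (cplx R).

Lemma normc_real (a : R) : `|a%:C%C : C| = (`|a|)%:C%C.
Proof. by rewrite normc_def /= expr0n /= addr0 sqrtr_sqr. Qed.

Lemma cvg_real_complex (a : R^nat) (l : R) :
  a @ \oo --> l -> (fun n => (a n)%:C%C : C) @ \oo --> (l%:C%C : C).
Proof.
move=> /cvgrPdist_le al; apply/cvgrPdist_le => e e0.
have /complex_realP[e' ee] : e \is Num.real by apply: gtr0_real.
rewrite ee in e0 *.
have {}e0 : 0 < e' by rewrite -ltcR.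
have := al e' e0; apply: filterS => n h.
have -> : (l%:C%C - (a n)%:C%C : C) = (l - a n)%:C%C by rewrite rmorphB.
by rewrite normc_real lecR.
Qed.

Lemma cvgn_real_cauchy (a : R^nat) :
  (forall e, 0 < e -> exists N, forall n, (N <= n)%N -> `|a n - a N| <= e) ->
  cvgn a.
Proof.
move=> h; apply: cauchy_cvg; apply: cauchy_exP => e e0.
have [|N hN] := h (e / 2); first by rewrite divr_gt0.
exists (a N); exists N => // n /= Nn; rewrite /ball /= distrC.
by apply: le_lt_trans (hN _ Nn) _; rewrite ltr_pdivrMr // ltr_pMr // ltr1n.
Qed.

Lemma cvgn_cauchy (u : C^nat) :
  (forall e : C, 0 < e ->
     exists N, forall n, (N <= n)%N -> `|u n - u N| <= e) ->
  cvgn u.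
Proof.
move=> h.
have hR (a : R^nat) : (forall n m, (`|a n - a m|)%:C%C <= `|u n - u m|) -> cvgn a.
  move=> au; apply: cvgn_real_cauchy => e e0.
  have [|N hN] := h e%:C%C; first by rewrite ltcR.
  by exists N => n Nn; rewrite -lecR; apply: le_trans (au _ _) (hN _ Nn).
have /cvg_ex[a ua] : cvgn (fun n => complex.Re (u n)).
  apply: hR => n m; apply: le_trans (normc_ge_Re _).
  by move: (u n) (u m) => [a b] [c d] /=.
have /cvg_ex[b ub] : cvgn (fun n => complex.Im (u n)).
  apply: hR => n m.
  have -> : `|u n - u m| = `|(u n - u m) * 'i%C|.
    by rewrite normrM [X in _ * X](_ : _ = 1) ?mulr1 // normc_def /= expr0n expr1n /= add0r sqrtr1.
  apply: le_trans (normc_ge_Re _); rewrite ReiNIm normrN.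
  by move: (u n) (u m) => [? ?] [? ?] /=.
apply/cvg_ex; exists (a%:C%C + 'i%C * b%:C%C).
have -> : u = (fun n => (complex.Re (u n))%:C%C + 'i%C * (complex.Im (u n))%:C%C).
  by apply/funext => n; rewrite -complexE.
apply: cvgD; first exact: cvg_real_complex ua.
by apply: cvgM; [exact: cvg_cst | exact: cvg_real_complex ub].
Qed.

Lemma cvgn_bounded_mono (u : C^nat) (M : C) :
  (forall n, 0 <= u n) -> (forall n, u n <= u n.+1) -> (forall n, u n <= M) ->
  cvgn u.
Proof.
move=> u0 uS uM.
have uE n : u n = (complex.Re (u n))%:C%C by rewrite RRe_real // ger0_real.
have ME : M = (complex.Re M)%:C%C.
  by rewrite RRe_real // ger0_real // (le_trans (u0 0%N)).
have /cvg_ex[a ua] : cvgn (fun n => complex.Re (u n)).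
  apply: nondecreasing_is_cvgn.
    by apply/nondecreasing_seqP => n; rewrite -lecR -!uE.
  by exists (complex.Re M) => _ [n _ <-]; rewrite -lecR -uE -ME.
apply/cvg_ex; exists (a%:C%C).
by rewrite (funext uE); exact: cvg_real_complex ua.
Qed.

Lemma cvgn_ext (u v : C^nat) (l : C) :
  (forall n, u n = v n) -> u @ \oo --> l -> v @ \oo --> l.
Proof. by move=> /funext ->. Qed.

Lemma cvgnD (u v : C^nat) (l l' : C) :
  u @ \oo --> l -> v @ \oo --> l' -> (fun n => u n + v n) @ \oo --> l + l'.
Proof. exact: cvgD. Qed.

Lemma cvgnB (u v : C^nat) (l l' : C) :
  u @ \oo --> l -> v @ \oo --> l' -> (fun n => u n - v n) @ \oo --> l - l'.
Proof. exact: cvgB. Qed.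

Lemma cvgnM (u v : C^nat) (l l' : C) :
  u @ \oo --> l -> v @ \oo --> l' -> (fun n => u n * v n) @ \oo --> l * l'.
Proof. exact: cvgM. Qed.

Lemma cvgnZ (u : C^nat) (l a : C) :
  u @ \oo --> l -> (fun n => a * u n) @ \oo --> a * l.
Proof. move=> h; exact: cvgnM (cvg_cst a) h. Qed.

Lemma cvgn_cst (a : C) : (fun=> a : C) @ \oo --> a.
Proof. exact: cvg_cst. Qed.

Lemma cvgn_unique (u : C^nat) (l l' : C) :
  u @ \oo --> l -> u @ \oo --> l' -> l = l'.
Proof. by move=> h h'; apply: (cvg_unique _ h h'). Qed.

Lemma cvgn_norm (u : C^nat) (l : C) :
  u @ \oo --> l -> (fun n => `|u n|) @ \oo --> `|l|.
Proof. exact: cvg_norm. Qed.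

Lemma cvgn_ge0 (u : C^nat) (l : C) :
  u @ \oo --> l -> (forall n, 0 <= u n) -> 0 <= l.
Proof.
move=> ul u0; apply/normr_idP; apply: (cvgn_unique _ ul).
rewrite (_ : u = (fun n => `|u n|)); last by apply/funext => n; rewrite ger0_norm.
exact: cvg_norm.
Qed.

Lemma cvgn_le (u v : C^nat) (l l' : C) :
  u @ \oo --> l -> v @ \oo --> l' -> (forall n, u n <= v n) -> l <= l'.
Proof.
move=> ul vl uv; rewrite -subr_ge0.
by apply: (cvgn_ge0 (cvgB vl ul)) => n /=; rewrite subr_ge0.
Qed.

Lemma cvgn_conj (u : C^nat) (l : C) :
  u @ \oo --> l -> (fun n => (u n)^*) @ \oo --> l^*.
Proof.
move=> /cvgrPdist_le ul; apply/cvgrPdist_le => e e0.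
by have := ul e e0; apply: filterS => n; rewrite -rmorphB /= norm_conjC.
Qed.

Lemma cvgn_shiftP (u : C^nat) (l : C) (n0 : nat) :
  (fun n => u (n + n0)%N) @ \oo --> l -> u @ \oo --> l.
Proof. by move=> h; rewrite -(cvg_shiftn n0 (V := C)). Qed.

Lemma cvgn_shift (u : C^nat) (l : C) (n0 : nat) :
  u @ \oo --> l -> (fun n => u (n + n0)%N) @ \oo --> l.
Proof. by move=> h; rewrite (cvg_shiftn n0 (V := C)). Qed.

Lemma cvgn_eventually (u : C^nat) (l : C) (n0 : nat) :
  (forall n, (n0 <= n)%N -> u n = l) -> u @ \oo --> l.
Proof.
move=> h; apply/cvgrPdist_le => e e0; exists n0 => // n /= /h ->.
by rewrite subrr normr0 ltW.
Qed.

Lemma cvgn_lim (u : C^nat) (l : C) : u @ \oo --> l -> limn u = l.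
Proof. by move=> h; apply: cvg_lim. Qed.

Lemma cvgn_sum (I : Type) (r : seq I) (P : pred I) (u : I -> C^nat) (l : I -> C) :
  (forall i, u i @ \oo --> l i) ->
  (fun n => \sum_(i <- r | P i) u i n) @ \oo --> \sum_(i <- r | P i) l i.
Proof.
move=> h; elim: r => [|i r IH].
  by rewrite big_nil; under eq_fun do rewrite big_nil; exact: cvg_cst.
rewrite big_cons; under eq_fun do rewrite big_cons.
by case: ifP => _; [exact: (cvgD (h i) IH) | exact: IH].
Qed.

Lemma cvgn_sqr_squeeze (a b : C^nat) (l : C) :
  (forall n, `|a n - l| ^+ 2 <= b n) -> b @ \oo --> 0 -> a @ \oo --> l.
Proof.
move=> ab /cvgrPdist_le b0; apply/cvgrPdist_le => e e0.
have e20 : 0 < e ^+ 2 by rewrite exprn_gt0.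
have := b0 _ e20; apply: filterS => n; rewrite sub0r normrN => bn.
have bR : b n \is Num.real by rewrite ger0_real // (le_trans _ (ab n)) // exprn_ge0.
have := le_trans (ab n) (le_trans (real_ler_norm bR) bn).
by rewrite distrC ler_pXn2r // nnegrE ?normr_ge0 // ltW.
Qed.

Lemma mono_le_lim (u : C^nat) (l : C) :
  (forall n, u n <= u n.+1) -> u @ \oo --> l -> forall n, u n <= l.
Proof.
move=> uS ul n; apply: (cvgn_le (@cvgn_cst (u n)) (cvgn_shift n ul)) => k.
elim: k => [|k IH]; first by rewrite add0n.
by rewrite addSn; exact: le_trans IH (uS _).
Qed.

End complex_limits.

(** * Square summability of the Taylor coefficients of bounded functions *)

Lemma prim_root_closed (K : numClosedFieldType) n : (0 < n)%N ->
  exists w : K, n.-primitive_root w.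
Proof.
move=> n0; have [rs ers] := closed_field_poly_normal ('X^n - 1 : {poly K}).
rewrite (monicP _) ?monicXnsubC // scale1r in ers.
have sz : (n < (size rs).+1)%N by rewrite -(size_prod_XsubC rs id) -ers size_XnsubC.
have rt : all n.-unity_root rs by apply/allP => x; rewrite -root_prod_XsubC -ers.
have un : uniq rs.
  by rewrite -separable_prod_XsubC -ers separable_Xn_sub_1 // pnatr_eq0 -lt0n.
by have /hasP[w _ wP] := has_prim_root n0 rt un sz; exists w.
Qed.

Lemma norm_sum_sqr (K : numClosedFieldType) n (c : 'I_n -> K) :
  `|\sum_i c i| ^+ 2 = \sum_i \sum_j c i * (c j)^*.
Proof.
rewrite normCK rmorph_sum /= mulr_suml; apply: eq_bigr => i _.
by rewrite mulr_sumr.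
Qed.

(** The characters of the cyclic group of order n are orthogonal. *)
Lemma discrete_parseval (K : numClosedFieldType) n (w : K) (b : nat -> K) :
  n.-primitive_root w ->
  \sum_(k < n) `|\sum_(i < n) b i * w ^+ k ^+ i| ^+ 2
  = n%:R * \sum_(i < n) `|b i| ^+ 2.
Proof.
move=> wP; have n0 := prim_order_gt0 wP.
have wn := prim_expr_order wP.
have nw : `|w| = 1.
  by apply/eqP; rewrite -(@pexpr_eq1 _ _ n) // -normrX wn normr1.
have ww : w * w^* = 1 by rewrite -normCK nw expr1n.
have orth (i j : 'I_n) : \sum_(k < n) w ^+ k ^+ i * (w ^+ k ^+ j)^* = (i == j)%:R * n%:R.
  under eq_bigr => k _.
    rewrite !rmorphXn /= -!exprM ![(k * _)%N]mulnC !exprM -exprMn.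
    over.
  have [->|ij] := eqVneq i j.
    rewrite mul1r; under eq_bigr do rewrite -exprMn ww !expr1n.
    by rewrite sumr_const card_ord.
  rewrite mul0r; set x := _ * _.
  have x1 : x != 1.
    apply: contra_neq ij => e; apply/val_inj/eqP.
    have e2 : w ^+ j * w^* ^+ j = 1 by rewrite -exprMn ww expr1n.
    have /eqP : w ^+ i = w ^+ j.
      by rewrite -[LHS]mulr1 -e2 [X in _ * X]mulrC mulrA -/x e mul1r.
    by rewrite (eq_prim_root_expr wP) !modn_small.
  have xn : x ^+ n = 1.
    by rewrite exprMn ![_ ^+ _ ^+ n]exprAC -rmorphXn wn /= rmorph1 !expr1n mulr1.
  apply/eqP; have := subrX1 x n; rewrite xn subrr => /esym/eqP.
  by rewrite mulf_eq0 subr_eq0 (negbTE x1).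
under eq_bigr do rewrite norm_sum_sqr.
rewrite exchange_big /= mulr_sumr; apply: eq_bigr => i _.
rewrite exchange_big /=.
transitivity (\sum_(j < n) b i * (b j)^* * ((i == j)%:R * n%:R)).
  apply: eq_bigr => j _; rewrite -orth mulr_sumr; apply: eq_bigr => k _.
  by rewrite rmorphM /= mulrACA.
rewrite (bigD1 i) //= eqxx mul1r big1 ?addr0; last first.
  by move=> j ji; rewrite eq_sym (negbTE ji) mul0r mulr0.
by rewrite -normCK mulrC.
Qed.

Lemma geom_sum_le (K : numFieldType) (q : K) n : 0 <= q -> q < 1 ->
  \sum_(k < n) q ^+ k <= (1 - q)^-1.
Proof.
move=> q0 q1; have r0 : 0 < 1 - q by rewrite subr_gt0.
rewrite -[leRHS]mulr1 ler_pdivlMl //.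
have e := subrX1 q n.
by rewrite -opprB mulNr -e opprB lerBlDr lerDl exprn_ge0.
Qed.

Lemma bernoulli_sub (K : numFieldType) (x : K) n : 0 <= x -> x <= 1 ->
  1 - n%:R * x <= (1 - x) ^+ n.
Proof.
move=> x0 x1; elim: n => [|n IH]; first by rewrite mul0r subr0 expr0.
rewrite exprS; apply: le_trans (_ : (1 - x) * (1 - n%:R * x) <= _); last first.
  by rewrite ler_wpM2l // subr_ge0.
rewrite -subr_ge0 [X in 0 <= X](_ : _ = n%:R * (x * x)); first by rewrite !mulr_ge0.
by rewrite -natr1; ring.
Qed.

#[local] Opaque cplx.

Section hardy.
Context {R : realType}.
Local Notation C := (cplx R).

Lemma series_term_cvg0 (u : C^nat) (l : C) : series u @ \oo --> l -> u @ \oo --> 0.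
Proof.
move=> h; have h2 := cvgnB (cvgn_shift 1 h) h; rewrite subrr in h2.
apply: cvgn_ext h2 => n; rewrite addn1 /series /= big_nat_recr //= addrAC.
by rewrite subrr add0r.
Qed.

Lemma cvgn_expr0 (q : C) : 0 <= q -> q < 1 -> (fun n => q ^+ n) @ \oo --> 0.
Proof.
move=> q0 q1.
have /cvg_ex[l] : cvgn (series (fun n => q ^+ n)).
  apply: (@cvgn_bounded_mono _ _ (1 - q)^-1) => n; rewrite /series /=.
  - by rewrite sumr_ge0 // => i _; rewrite exprn_ge0.
  - by rewrite big_nat_recr //= lerDl exprn_ge0.
  - by rewrite big_mkord; exact: geom_sum_le.
exact: series_term_cvg0.
Qed.

Lemma eventually_norm_le (u : C^nat) (e : C) : u @ \oo --> 0 -> 0 < e ->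
  exists N, forall n, (N <= n)%N -> `|u n| <= e.
Proof.
move=> /cvgrPdist_le h e0; have [N _ hN] := h e e0.
by exists N => n /hN; rewrite /= sub0r normrN.
Qed.

(** The terms of the series are bounded at the radius (r + 1) / 2, so on the
    circle of radius r the tails are dominated by those of a geometric
    series. *)
Lemma expansion_uniform (f : C -> C) (a : C^nat) (r M : C) N :
  disc_expansion f a -> 0 < r -> r < 1 -> 0 < M ->
  exists L, [/\ (N < L)%N & forall z, `|z| = r ->
    `|f z - series (fun n => a n * z ^+ n) L| <= M].
Proof.
move=> fa r0 r1 M0.
pose rho : C := (r + 1) / 2%:R.
have rrho : r < rho by rewrite /rho midf_lt.
have rho1 : rho < 1 by rewrite /rho midf_lt.
have rho0 : 0 < rho := lt_trans r0 rrho.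
pose q := r / rho.
have q0 : 0 <= q by rewrite /q divr_ge0 // ltW.
have q1 : q < 1 by rewrite /q ltr_pdivrMr // mul1r.
have q1' : 0 < 1 - q by rewrite subr_gt0.
have rhon : `|rho| < 1 by rewrite gtr0_norm.
have [N0 hN0] := eventually_norm_le (series_term_cvg0 (fa rho rhon)) (@ltr01 C).
have [N1 hN1] := eventually_norm_le (cvgn_expr0 q0 q1) (mulr_gt0 M0 q1').
pose L := maxn N.+1 (maxn N0 N1).
have L1 : (N.+1 <= L)%N by exact: leq_maxl.
have L2 : (N0 <= L)%N by rewrite (leq_trans (leq_maxl N0 N1)) // leq_maxr.
have L3 : (N1 <= L)%N by rewrite (leq_trans (leq_maxr N0 N1)) // leq_maxr.
exists L; split=> // z zr.
have term n : (L <= n)%N -> `|a n * z ^+ n| <= q ^+ n.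
  move=> Ln; have := hN0 n (leq_trans L2 Ln).
  rewrite !normrM !normrX zr (gtr0_norm rho0) => h.
  have -> : r = rho * q by rewrite /q mulrC divfK // gt_eqF.
  by rewrite exprMn mulrA ler_piMl // exprn_ge0.
have z1 : `|z| < 1 by rewrite zr.
have fz := cvgn_shift L (fa z z1).
have h := cvgn_norm (cvgnB fz (cvgn_cst (a := series (fun n => a n * z ^+ n) L))).
apply: (cvgn_le h (cvgn_cst (a := M))) => j.
have -> : series (fun n => a n * z ^+ n) (j + L)%N - series (fun n => a n * z ^+ n) L
    = \sum_(L <= k < j + L) a k * z ^+ k.
  by rewrite /series /= (big_cat_nat (n := L)) //= ?leq_addl // addrAC subrr add0r.
apply: le_trans (ler_norm_sum _ _ _) _.
apply: le_trans (_ : \sum_(L <= k < j + L) q ^+ k <= _).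
  by apply: ler_sum_nat => k /andP[Lk _]; exact: term.
rewrite -{1}[L]add0n big_addn addnK big_mkord.
under eq_bigr do rewrite exprD.
rewrite -mulr_suml.
have := hN1 L L3; rewrite ger0_norm ?exprn_ge0 // => qL.
apply: le_trans (_ : (1 - q)^-1 * (M * (1 - q)) <= _); last first.
  by rewrite mulrCA mulVf ?mulr1 // gt_eqF.
apply: ler_pM => //; first by rewrite sumr_ge0 // => i _; rewrite exprn_ge0.
  by rewrite exprn_ge0.
exact: geom_sum_le.
Qed.

(** The mean square of f over the vertices of a regular polygon of radius
    r < 1 is, up to a uniformly small tail, the sum of the |a_n|^2 r^(2 n). *)
Lemma coef_sqr_sum_le (f : C -> C) (a : C^nat) (M : C) N :
  disc_expansion f a -> 0 < M -> (forall z, `|z| < 1 -> `|f z| <= M) ->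
  \sum_(k < N) `|a k| ^+ 2 <= 8%:R * M ^+ 2.
Proof.
move=> fa M0 fM.
(* With r = 1 - 1 / (4 (N + 1)), Bernoulli gives r^(2 i) >= 1/2 for i < N. *)
pose x : C := (4 * N.+1)%:R^-1.
have x0 : 0 < x by rewrite invr_gt0 ltr0n.
have x1 : x < 1 by rewrite invf_lt1 ?ltr0n // ltr1n; case: (N).
pose r := 1 - x.
have r0 : 0 < r by rewrite subr_gt0.
have r1 : r < 1 by rewrite /r ltrBlDr ltrDl.
have [L [NL tail]] := expansion_uniform N fa r0 r1 M0.
have L0 : (0 < L)%N by exact: leq_trans NL.
have [w wP] := @prim_root_closed C L L0.
have nw : `|w| = 1.
  by apply/eqP; rewrite -(@pexpr_eq1 _ _ L) // -normrX (prim_expr_order wP) normr1.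
have pars := discrete_parseval (fun i => a i * r ^+ i) wP.
have le4 : \sum_(i < L) `|a i * r ^+ i| ^+ 2 <= 4%:R * M ^+ 2.
  have Lp : 0 < L%:R :> C by rewrite ltr0n.
  rewrite -(ler_pM2l Lp) -pars.
  have -> : L%:R * (4%:R * M ^+ 2) = \sum_(k < L) (M + M) ^+ 2.
    have -> : (M + M) ^+ 2 = 4%:R * M ^+ 2 by rewrite -(mulr2n M) -(mulr_natl M 2) exprMn -natrX.
    by rewrite sumr_const card_ord [LHS]mulr_natl.
  apply: ler_sum => k _; apply: lerXn2r; rewrite ?nnegrE ?normr_ge0 //.
    by rewrite addr_ge0 // ltW.
  have zr : `|r * w ^+ k| = r by rewrite normrM normrX nw expr1n mulr1 gtr0_norm.
  have -> : \sum_(i < L) a i * r ^+ i * w ^+ k ^+ i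
    = f (r * w ^+ k) - (f (r * w ^+ k) - series (fun n => a n * (r * w ^+ k) ^+ n) L).
    rewrite subKr /series /= big_mkord; apply: eq_bigr => i _.
    by rewrite exprMn mulrA.
  apply: le_trans (ler_normB _ _) _; apply: lerD; last exact: tail.
  by apply: fM; rewrite zr.
have -> : 8%:R * M ^+ 2 = 2%:R * (4%:R * M ^+ 2) by rewrite mulrA -natrM.
apply: le_trans (_ : 2%:R * \sum_(i < L) `|a i * r ^+ i| ^+ 2 <= _); last first.
  by rewrite ler_pM2l ?ltr0n.
apply: le_trans (_ : 2%:R * \sum_(i < N) `|a i * r ^+ i| ^+ 2 <= _); last first.
  rewrite ler_pM2l ?ltr0n // (big_ord_widen L (fun i => `|a i * r ^+ i| ^+ 2)) ?(ltnW NL) //.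
  rewrite [leRHS](bigID (fun i : 'I_L => (i < N)%N)) /= lerDl.
  by rewrite sumr_ge0 // => i _; rewrite exprn_ge0.
rewrite mulr_sumr; apply: ler_sum => i _.
rewrite normrM normrX (gtr0_norm r0) exprMn mulrCA.
rewrite ler_peMr ?exprn_ge0 // -exprM.
have b := bernoulli_sub (i * 2)%N (ltW x0) (ltW x1).
rewrite -ler_pdivrMl ?ltr0n // mulr1; apply: le_trans b.
rewrite lerBrDr -lerBrDl.
have -> : 1 - 2%:R^-1 = 2%:R^-1 :> C.
  by rewrite [X in X - _](splitr 1) mul1r addrK.
rewrite /x ler_pdivrMr ?ltr0n // ler_pdivlMl ?ltr0n //.
by rewrite -natrM ler_nat; have := ltn_ord i; lia.
Qed.

Lemma bounded_sqr_small0 (t : C) :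
  (forall M : C, 0 < M -> `|t| ^+ 2 <= 8%:R * M ^+ 2) -> t = 0.
Proof.
move=> h; apply/eqP/negPn/negP => t0.
have tp : 0 < `|t| by rewrite normr_gt0.
have t4 : 0 < `|t| / 4%:R by rewrite divr_gt0 ?ltr0n.
have := h _ t4; rewrite exprMn exprVn mulrCA -natrX ler_pMr ?exprn_gt0 //.
by rewrite ler_pdivlMr ?ltr0n // mul1r ler_nat.
Qed.

(** The difference of two expansions sums to 0, a function bounded by every
    positive M. *)
Lemma disc_expansion_unique (f : C -> C) (a b : C^nat) :
  disc_expansion f a -> disc_expansion f b -> a = b.
Proof.
move=> fa fb.
have f0 : disc_expansion (fun=> 0) (fun n => a n - b n).
  move=> z z1; have := cvgnB (fa z z1) (fb z z1); rewrite subrr => h.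
  apply: cvgn_ext h => n; rewrite /series /= -sumrB; apply: eq_bigr => k _.
  by rewrite mulrBl.
apply/funext => n; apply/subr0_eq/bounded_sqr_small0 => M M0.
have := @coef_sqr_sum_le _ _ M n.+1 f0 M0; rewrite big_ord_recr /=.
move=> h; apply: le_trans (h _); last by move=> z _; rewrite normr0 ltW.
by rewrite lerDr sumr_ge0 // => i _; rewrite exprn_ge0.
Qed.

Lemma taylor1E (f : C -> C) (a : C^nat) : disc_expansion f a -> taylor1 f = a.
Proof.
move=> fa; rewrite /taylor1; case: xgetP => [b _ fb|/(_ a)//].
exact: disc_expansion_unique fb fa.
Qed.

Lemma Hinfty1_taylor (f : C -> C) : Hinfty1 f ->
  exists B : C, forall N, \sum_(k < N) `|taylor1 f k| ^+ 2 <= B.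
Proof.
move=> [[a fa] [M fM]]; rewrite (taylor1E fa).
have M0 : 0 <= M by apply: le_trans (fM 0 _); rewrite ?normr_ge0 // normr0 ltr01.
exists (8%:R * (M + 1) ^+ 2) => N; apply: (@coef_sqr_sum_le f a (M + 1) N fa).
  by rewrite ltr_wpDl.
by move=> z /fM h; apply: le_trans h _; rewrite lerDl ler01.
Qed.

End hardy.

(** * The sequence space *)

Lemma polarization_scalar (K : numClosedFieldType) (a b c d : K) :
  4%:R * b = (a + b + c + d) - (a - b - c + d)
    + 'i * (a - 'i * b + 'i * c + d) - 'i * (a + 'i * b - 'i * c + d).
Proof.
have ii : 'i * 'i = -1 :> K by rewrite -expr2 sqrCi.
apply/eqP; rewrite -subr_eq0; apply/eqP.
transitivity ((1 + 'i * 'i) * (2%:R * b - 2%:R * c)); first by ring.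
by rewrite ii subrr mul0r.
Qed.

Lemma parallelogram_scalar (K : numClosedFieldType) (a b c d : K) :
  (a + b + c + d) + (a - b - c + d) = 2%:R * a + 2%:R * d.
Proof. ring. Qed.

Section dot_product.
Context {R : realType}.
Local Notation C := (cplx R).

Lemma dotcE n (x y : 'cV[C]_n) : dotc x y = \sum_i (y i 0)^* * x i 0.
Proof. by rewrite /dotc mxE; apply: eq_bigr => i _; rewrite !mxE. Qed.

Lemma dotc_conj n (x y : 'cV[C]_n) : dotc y x = (dotc x y)^*.
Proof.
rewrite !dotcE rmorph_sum; apply: eq_bigr => i _ /=.
by rewrite rmorphM /= conjCK mulrC.
Qed.

Lemma dotcDl n (x y z : 'cV[C]_n) : dotc (x + y) z = dotc x z + dotc y z.
Proof. by rewrite /dotc mulmxDr mxE. Qed.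

Lemma dotcZl n a (x z : 'cV[C]_n) : dotc (a *: x) z = a * dotc x z.
Proof. by rewrite /dotc -scalemxAr mxE. Qed.

Lemma dotc0l n (z : 'cV[C]_n) : dotc 0 z = 0.
Proof. by rewrite /dotc mulmx0 mxE. Qed.

Lemma dotcDr n (x y z : 'cV[C]_n) : dotc z (x + y) = dotc z x + dotc z y.
Proof. by rewrite dotc_conj dotcDl rmorphD /= -!dotc_conj. Qed.

Lemma dotcZr n a (x z : 'cV[C]_n) : dotc z (a *: x) = a^* * dotc z x.
Proof. by rewrite dotc_conj dotcZl rmorphM /= -dotc_conj. Qed.

Lemma dotc0r n (z : 'cV[C]_n) : dotc z 0 = 0.
Proof. by rewrite dotc_conj dotc0l rmorph0. Qed.

Lemma dotc_mulmxl n k (A : 'M[C]_(n, k)) x y :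
  dotc (A *m x) y = dotc x (A^t* *m y).
Proof.
by rewrite /dotc mulmxA trmx_mul map_mxM /= trmxCK.
Qed.

Lemma dotc_norm n (x : 'cV[C]_n) : dotc x x = \sum_i `|x i 0| ^+ 2.
Proof. by rewrite dotcE; apply: eq_bigr => i _; rewrite normCKC. Qed.

Lemma dotc_ge0 n (x : 'cV[C]_n) : 0 <= dotc x x.
Proof. by rewrite dotc_norm sumr_ge0 // => i _; rewrite exprn_ge0. Qed.

Lemma dotc_eq0 n (x : 'cV[C]_n) : dotc x x = 0 -> x = 0.
Proof.
rewrite dotc_norm => /eqP; rewrite psumr_eq0; last by move=> i _; rewrite exprn_ge0.
move=> /allP h; apply/matrixP => i j; rewrite mxE ord1; apply/eqP.
by have := h i (mem_index_enum _); rewrite /= sqrf_eq0 normr_eq0.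
Qed.

Lemma le_dotc_coord n (x : 'cV[C]_n) i : `|x i 0| ^+ 2 <= dotc x x.
Proof.
rewrite dotc_norm (bigD1 i) //= lerDl sumr_ge0 // => j _; exact: exprn_ge0.
Qed.

Lemma dotc_delta n (x : 'cV[C]_n) i : dotc x (delta_mx i 0) = x i 0.
Proof.
rewrite dotcE (bigD1 i) //= mxE !eqxx conjC1 mul1r big1 ?addr0 // => j ji.
by rewrite mxE (negbTE ji) conjC0 mul0r.
Qed.

#[local] Opaque dotc.

Lemma conjCN (a : C) : (- a)^* = - a^*.
Proof. exact: rmorphN. Qed.

Lemma dotc_sqrD n a (x y : 'cV[C]_n) :
  dotc (x + a *: y) (x + a *: y)
  = dotc x x + a^* * dotc x y + a * dotc y x + a * a^* * dotc y y.
Proof. by rewrite dotcDl !dotcDr dotcZl dotcZr dotcZl dotcZr mulrA addrA. Qed.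

Lemma dotc_sqrDD n (x y : 'cV[C]_n) :
  dotc (x + y) (x + y) = dotc x x + dotc x y + dotc y x + dotc y y.
Proof.
by rewrite -[X in dotc (x + X) _]scale1r -[X in dotc _ (x + X)]scale1r dotc_sqrD conjC1 !mul1r.
Qed.

Lemma dotc_sqrB n (x y : 'cV[C]_n) :
  dotc (x - y) (x - y) = dotc x x - dotc x y - dotc y x + dotc y y.
Proof.
rewrite -[X in dotc (x + X) _]scaleN1r -[X in dotc _ (x + X)]scaleN1r dotc_sqrD.
by rewrite conjCN conjC1 mulrNN !mul1r !mulN1r.
Qed.

Lemma dotc_parallelogram n (x y : 'cV[C]_n) :
  dotc (x + y) (x + y) + dotc (x - y) (x - y)
  = 2%:R * dotc x x + 2%:R * dotc y y.
Proof.
by rewrite -(parallelogram_scalar _ (dotc x y) (dotc y x)) dotc_sqrDD dotc_sqrB.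
Qed.

(** Polarization reduces the convergence of inner products of sequences to
    that of squared norms. *)
Lemma dotc_polar n (x y : 'cV[C]_n) :
  4%:R * dotc x y = dotc (x + y) (x + y) - dotc (x - y) (x - y)
    + 'i * dotc (x + 'i *: y) (x + 'i *: y)
    - 'i * dotc (x - 'i *: y) (x - 'i *: y).
Proof.
rewrite (polarization_scalar (dotc x x) _ (dotc y x) (dotc y y)).
congr (_ - _ + _ * _ - _ * _).
- by rewrite dotc_sqrDD.
- by rewrite dotc_sqrB.
- by rewrite dotc_sqrD -normCK normCi expr1n mul1r conjCi mulNr.
- rewrite -[X in dotc (x + X) _]scaleNr -[X in dotc _ (x + X)]scaleNr dotc_sqrD.
  by rewrite -normCK normrN normCi expr1n mul1r conjCN conjCi opprK mulNr.
Qed.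

End dot_product.

Section ell2_space.
Context {R : realType}.
Local Notation C := (cplx R).
Variable n : nat.
Implicit Types x y z : ell2 (R:=R) n.
Local Notation l2 := (hmem (ell2 (R:=R) n)).

Lemma psum_mono x N :
  series (fun k => dotc (x k) (x k)) N <= series (fun k => dotc (x k) (x k)) N.+1.
Proof. by rewrite /series /= big_nat_recr //= lerDl dotc_ge0. Qed.

Lemma psum_ge0 x N : 0 <= series (fun k => dotc (x k) (x k)) N.
Proof. by rewrite /series /= sumr_ge0 // => i _; rewrite dotc_ge0. Qed.

Lemma l2_bounded x (M : C) :
  (forall N, series (fun k => dotc (x k) (x k)) N <= M) -> l2 x.
Proof. move=> h; exact: cvgn_bounded_mono (psum_ge0 x) (psum_mono x) h. Qed.

Lemma psum_le x N : l2 x -> series (fun k => dotc (x k) (x k)) N <= hdot x x.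
Proof.
move=> lx; have /cvg_ex[l hl] : cvgn (series (fun k => dotc (x k) (x k))) := lx.
by rewrite /= (cvgn_lim hl); exact: (mono_le_lim (psum_mono x) hl).
Qed.

Lemma l2_norm_le x (M : C) :
  (forall N, series (fun k => dotc (x k) (x k)) N <= M) -> hdot x x <= M.
Proof.
move=> h; have /cvg_ex[l hl] := l2_bounded h.
rewrite /= (cvgn_lim hl); exact: (cvgn_le hl (cvg_cst M)).
Qed.

Lemma l2_add x y : l2 x -> l2 y -> l2 (x + y).
Proof.
move=> lx ly; apply: (@l2_bounded _ (2%:R * hdot x x + 2%:R * hdot y y)) => N.
apply: le_trans (_ : 2%:R * series (fun k => dotc (x k) (x k)) N
    + 2%:R * series (fun k => dotc (y k) (y k)) N <= _); last first.
  by rewrite lerD // ler_pM2l ?ltr0n // psum_le.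
rewrite /series /= !mulr_sumr -big_split /=; apply: ler_sum => k _.
by rewrite -dotc_parallelogram lerDl dotc_ge0.
Qed.

Lemma l2_scale a x : l2 x -> l2 (a *: x).
Proof.
move=> lx; apply: (@l2_bounded _ (`|a| ^+ 2 * hdot x x)) => N.
apply: le_trans (_ : `|a| ^+ 2 * series (fun k => dotc (x k) (x k)) N <= _); last first.
  by rewrite ler_wpM2l ?exprn_ge0 // psum_le.
rewrite /series /= mulr_sumr; apply: ler_sum => k _.
by rewrite [(a *: x) k](_ : _ = a *: x k) // dotcZl dotcZr mulrA normCK.
Qed.

Lemma l2_opp x : l2 x -> l2 (- x).
Proof. by rewrite -scaleN1r; exact: l2_scale. Qed.

Lemma l2_sub x y : l2 x -> l2 y -> l2 (x - y).
Proof. by move=> lx ly; apply: (l2_add lx); exact: l2_opp. Qed.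

Lemma hdot_cvg x y : l2 x -> l2 y ->
  series (fun k => dotc (x k) (y k)) @ \oo --> hdot x y.
Proof.
move=> lx ly.
suff /cvg_ex[l hl] : cvgn (series (fun k => dotc (x k) (y k))) by rewrite /= (cvgn_lim hl).
pose s z := series (fun k => dotc (z k) (z k)).
have -> : series (fun k => dotc (x k) (y k)) = (fun N => 4%:R^-1 *
   (s (x + y) N - s (x - y) N + 'i * s (x + 'i *: y) N - 'i * s (x - 'i *: y) N)).
  apply/funext => N; rewrite /s /series /= !mulr_sumr -!sumrB -big_split -sumrB mulr_sumr /=.
  by apply: eq_bigr => k _; rewrite -dotc_polar mulrA mulVf ?mul1r // pnatr_eq0.
have ls z : l2 z -> s z @ \oo --> hdot z z by [].
apply/cvg_ex; eexists; apply: cvgM; first exact: cvg_cst.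
apply: cvgB; [apply: cvgD; [apply: cvgB|apply: cvgM; first exact: cvg_cst] |
   apply: cvgM; first exact: cvg_cst].
- exact: ls (l2_add lx ly).
- exact: ls (l2_sub lx ly).
- exact: ls (l2_add lx (l2_scale ly)).
- exact: ls (l2_sub lx (l2_scale ly)).
Qed.

Lemma hdot_eq (l : C) x y :
  series (fun k => dotc (x k) (y k)) @ \oo --> l -> hdot x y = l.
Proof. exact: cvgn_lim. Qed.

#[local] Opaque hmem.

Lemma hdot0l x : hdot 0 x = 0.
Proof.
apply: hdot_eq; apply: (@cvgn_eventually _ _ _ 0%N) => k _.
by rewrite /series /= big1 // => i _; rewrite dotc0l.
Qed.

Lemma hdot0r x : hdot x 0 = 0.
Proof.
apply: hdot_eq; apply: (@cvgn_eventually _ _ _ 0%N) => k _.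
by rewrite /series /= big1 // => i _; rewrite dotc0r.
Qed.

Lemma l2_0 : l2 0.
Proof.
by apply: (@l2_bounded _ 0) => N; rewrite /series /= big1 // => i _; rewrite dotc0l.
Qed.

Lemma hdotDl x y z : l2 x -> l2 y -> l2 z -> hdot (x + y) z = hdot x z + hdot y z.
Proof.
move=> lx ly lz; apply: hdot_eq.
apply: cvgn_ext (cvgnD (hdot_cvg lx lz) (hdot_cvg ly lz)) => N.
by rewrite /series /= -big_split; apply: eq_bigr => k _; rewrite dotcDl.
Qed.

Lemma hdotZl a x z : l2 x -> l2 z -> hdot (a *: x) z = a * hdot x z.
Proof.
move=> lx lz; apply: hdot_eq.
apply: cvgn_ext (cvgnZ (a := a) (hdot_cvg lx lz)) => N.
by rewrite /series /= mulr_sumr; apply: eq_bigr => k _; rewrite dotcZl.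
Qed.

Lemma hdot_conj x y : l2 x -> l2 y -> hdot y x = (hdot x y)^*.
Proof.
move=> lx ly; apply: hdot_eq.
apply: cvgn_ext (cvgn_conj (hdot_cvg lx ly)) => N.
by rewrite /series /= rmorph_sum; apply: eq_bigr => k _; rewrite /= -dotc_conj.
Qed.

Lemma hdotDr x y z : l2 x -> l2 y -> l2 z -> hdot z (x + y) = hdot z x + hdot z y.
Proof.
move=> lx ly lz; rewrite (hdot_conj (l2_add lx ly) lz) hdotDl // rmorphD /=.
by rewrite -!hdot_conj.
Qed.

Lemma hdotZr a x z : l2 x -> l2 z -> hdot z (a *: x) = a^* * hdot z x.
Proof.
move=> lx lz; rewrite (hdot_conj (l2_scale (a := a) lx) lz) hdotZl // rmorphM /=.
by rewrite -!hdot_conj.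
Qed.

Lemma hdotNl x z : l2 x -> l2 z -> hdot (- x) z = - hdot x z.
Proof. by move=> lx lz; rewrite -[- x]scaleN1r (hdotZl _ lx lz) mulN1r. Qed.

Lemma hdotNr x z : l2 x -> l2 z -> hdot z (- x) = - hdot z x.
Proof.
by move=> lx lz; rewrite -[- x]scaleN1r (hdotZr _ lx lz) conjCN conjC1 mulN1r.
Qed.

Lemma hdotBl x y z : l2 x -> l2 y -> l2 z -> hdot (x - y) z = hdot x z - hdot y z.
Proof.
by move=> lx ly lz; rewrite (hdotDl lx (l2_opp ly) lz) (hdotNl ly lz).
Qed.

Lemma hdotBr x y z : l2 x -> l2 y -> l2 z -> hdot z (x - y) = hdot z x - hdot z y.
Proof.
by move=> lx ly lz; rewrite (hdotDr lx (l2_opp ly) lz) (hdotNr ly lz).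
Qed.

Lemma hdot_ge0 x : l2 x -> 0 <= hdot x x.
Proof. by move=> lx; apply: (cvgn_ge0 (hdot_cvg lx lx)) => N; exact: psum_ge0. Qed.

Lemma dotc_le_hdot x k : l2 x -> dotc (x k) (x k) <= hdot x x.
Proof.
move=> lx; apply: le_trans (psum_le k.+1 lx).
by rewrite /series /= big_nat_recr //= lerDr; exact: psum_ge0.
Qed.

Lemma hdot_eq0 x : l2 x -> hdot x x = 0 -> x = 0.
Proof.
move=> lx h; apply/funext => k; apply: dotc_eq0.
by apply: le_anti; rewrite dotc_ge0 andbT -h; exact: dotc_le_hdot.
Qed.

Let CS_scalar (c d a a' : C) :
  c * (c * d - a' * a) - a * (c * a' - a' * c) = c * (d * c - a * a').
Proof. by rewrite [a' * c]mulrC subrr mulr0 subr0 [a' * a]mulrC [d * c]mulrC. Qed.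

(** Expand the squared norm of <y, y> x - <x, y> y. *)
Lemma hdot_CS x y : l2 x -> l2 y -> `|hdot x y| ^+ 2 <= hdot x x * hdot y y.
Proof.
move=> lx ly; have [/hdot_eq0 -> //|y0] := eqVneq (hdot y y) 0.
  by rewrite !hdot0r normr0 expr0n mulr0.
have yp : 0 < hdot y y by rewrite lt_def y0 hdot_ge0.
set a := hdot x y; set b := hdot y y.
have bR : b^* = b by apply/CrealP; rewrite ger0_real // hdot_ge0.
have lbx := l2_scale (a := b) lx; have lay := l2_scale (a := a) ly.
have lw := l2_sub lbx lay; set w := _ - _ in lw.
have hw u : l2 u -> hdot u w = b * hdot u x - a^* * hdot u y.
  move=> lu; rewrite (hdotBr lbx lay lu) (hdotZr _ lx lu) (hdotZr _ ly lu).
  by rewrite bR.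
have := hdot_ge0 lw.
rewrite {1}/w (hdotBl lbx lay lw) (hdotZl _ lx lw) (hdotZl _ ly lw).
rewrite (hw x lx) (hw y ly) (hdot_conj lx ly) -/a -/b.
have -> : b * (b * hdot x x - a^* * a) - a * (b * a^* - a^* * b)
  = b * (hdot x x * b - a * a^*) by exact: CS_scalar.
by rewrite pmulr_rge0 // subr_ge0 normCK.
Qed.

(** The Fatou property: a bound on the norms passes to each partial sum of
    the squared norm of the limit, as these are finite sums.  Together with
    completeness of the scalars it replaces completeness of ell^2. *)
Lemma l2_fatou (u : nat -> ell2 n) x (M : C) :
  (forall j, l2 (u j) /\ hdot (u j) (u j) <= M) ->
  (forall k i, (fun j => u j k i 0) @ \oo --> x k i 0) ->
  l2 x /\ hdot x x <= M.
Proof.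
move=> hu ux; suff h N : series (fun k => dotc (x k) (x k)) N <= M.
  by split; [exact: l2_bounded h | exact: l2_norm_le].
apply: (@cvgn_le _ (fun j => series (fun k => dotc (u j k) (u j k)) N) (fun=> M)).
- rewrite /series /=; under eq_fun do under eq_bigr do rewrite dotcE.
  under eq_bigr do rewrite dotcE.
  apply: cvgn_sum => k; apply: cvgn_sum => i.
  by apply: cvgM; [apply: cvgn_conj|]; exact: ux.
- exact: cvg_cst.
- by move=> j; apply: le_trans (hu j).2; apply: psum_le; exact: (hu j).1.
Qed.

End ell2_space.

(** * Shifts *)

#[local] Opaque hdot.

Lemma convex_scalar (K : numClosedFieldType) (r A B c c' w w' : K) :
  0 < r -> w * w' = r * r ->
  0 <= r * r * A + r * - ((1 - r) * w') * c + - ((1 - r) * w) * r * c'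
    + - ((1 - r) * w) * - ((1 - r) * w') * B ->
  (1 - r) * (1 * 1 * A + 1 * w' * c + w * 1 * c' + w * w' * B)
    <= A + r * (1 - r) * B.
Proof.
move=> r0 ww h; rewrite -subr_ge0.
rewrite -(pmulr_rge0 _ r0); apply: le_trans h _.
rewrite -subr_ge0.
have -> : 0 = (1 - r) * (r * r - w * w') * B by rewrite ww subrr mulr0 mul0r.
by rewrite le_eqVlt; apply/orP; left; apply/eqP; ring.
Qed.

Lemma bilinear_scalar (K : numClosedFieldType) (a a' b b' p q s t : K) :
  a * (a' * p + b' * q) + b * (a' * s + b' * t)
  = a * a' * p + a * b' * q + b * a' * s + b * b' * t.
Proof. ring. Qed.

Section shift.
Context {R : realType}.
Local Notation C := (cplx R).
Variable n : nat.
Implicit Types (x y z : ell2 (R:=R) n) (u v : 'cV[C]_n).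
Local Notation l2 := (hmem (ell2 (R:=R) n)).
Local Notation S := (@block_shift R n).
Local Notation E := (@emb R n).

Definition tail x : ell2 n := fun k => x k.+1.

Lemma ell2_split x : x = E (x 0%N) + S (tail x).
Proof.
apply/funext => -[|k].
  by rewrite -[RHS]/(x 0%N + 0) addr0.
by rewrite -[RHS]/(0 + x k.+1) add0r.
Qed.

Lemma series_recl (f : C^nat) N :
  series f N.+1 = f 0%N + series (fun k => f k.+1) N.
Proof. by rewrite /series /= big_nat_recl. Qed.

Lemma l2_tail x : l2 x -> l2 (tail x).
Proof.
move=> lx; apply: (@l2_bounded _ _ _ (hdot x x)) => N.
by apply: le_trans (psum_le N.+1 lx); rewrite series_recl lerDr dotc_ge0.
Qed.

Lemma l2_of_tail x : l2 (tail x) -> l2 x.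
Proof.
move=> lx; apply: (@l2_bounded _ _ _ (dotc (x 0%N) (x 0%N) + hdot (tail x) (tail x))) => -[|N].
  by rewrite /series /= big_geq // addr_ge0 ?dotc_ge0 // hdot_ge0.
by rewrite series_recl lerD2l; exact: psum_le.
Qed.

Lemma l2_shift x : l2 x -> l2 (S x).
Proof. by move=> lx; apply: l2_of_tail. Qed.

Lemma l2_emb u : l2 (E u).
Proof. apply: l2_of_tail; exact: l2_0. Qed.

Lemma hdot_recl x y : l2 x -> l2 y ->
  hdot x y = dotc (x 0%N) (y 0%N) + hdot (tail x) (tail y).
Proof.
move=> lx ly; apply: hdot_eq; apply: (@cvgn_shiftP _ _ _ 1).
have h := cvgnD (cvgn_cst (a := dotc (x 0%N) (y 0%N))) (hdot_cvg (l2_tail lx) (l2_tail ly)).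
refine (cvgn_ext _ h) => N.
by rewrite addn1 series_recl.
Qed.

Lemma hdot_shift x y : l2 x -> l2 y -> hdot (S x) (S y) = hdot x y.
Proof.
by move=> lx ly; rewrite (hdot_recl (l2_shift lx) (l2_shift ly)) dotc0l add0r.
Qed.

Lemma hdot_embl u y : hdot (E u) y = dotc u (y 0%N).
Proof.
apply: hdot_eq; apply: (@cvgn_eventually _ _ _ 1) => -[//|N] _.
rewrite series_recl /series /= big1 ?addr0 // => k _; exact: dotc0l.
Qed.

Lemma hdot_embr u x : hdot x (E u) = dotc (x 0%N) u.
Proof.
apply: hdot_eq; apply: (@cvgn_eventually _ _ _ 1) => -[//|N] _.
rewrite series_recl /series /= big1 ?addr0 // => k _; exact: dotc0r.
Qed.

Lemma hdot_inj x y : l2 x -> l2 y -> (forall z, l2 z -> hdot z x = hdot z y) -> x = y.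
Proof.
move=> lx ly h; have ld := l2_sub lx ly.
apply/subr0_eq; apply: (hdot_eq0 ld).
by rewrite (hdotBr lx ly ld) (h _ ld) subrr.
Qed.

Lemma hadj_emb y : hadj E y = y 0%N.
Proof.
rewrite /hadj; case: xgetP => [x _ [_ hx]|/(_ (y 0%N)) []]; last first.
  by split => // u _; rewrite hdot_embl.
apply/eqP; rewrite -subr_eq0; apply/eqP; apply: dotc_eq0.
have h u : dotc u x = dotc u (y 0%N) by rewrite -hdot_embl; symmetry; exact: hx.
rewrite dotcDr (h _) -dotcDr; move: (dotc0r (x - y 0%N)) => <-.
by rewrite subrr.
Qed.

Lemma hadj_shift y : l2 y -> hadj S y = tail y.
Proof.
move=> ly; have hy x : l2 x -> hdot (S x) y = hdot x (tail y).
  by move=> lx; rewrite (hdot_recl (l2_shift lx) ly) dotc0l add0r.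
rewrite /hadj; case: xgetP => [x _ [lx hx]|/(_ (tail y)) []]; last first.
  by split; [exact: l2_tail | move=> x lx; exact: hy].
apply: (hdot_inj lx (l2_tail ly)) => z lz.
by rewrite -hy // hx.
Qed.

(** * Szego kernels and the resolvent of the backward shift *)

Definition szego (z : C) u : ell2 n := fun k => z ^+ k *: u.

Lemma norm_lt1_sqr (z : C) : `|z| < 1 -> 0 < 1 - `|z| ^+ 2.
Proof. by move=> h; rewrite subr_gt0 expr_lt1. Qed.

Lemma l2_szego (z : C) u : `|z| < 1 -> l2 (szego z u).
Proof.
move=> z1; have q1 := norm_lt1_sqr z1.
apply: (@l2_bounded _ _ _ ((1 - `|z| ^+ 2)^-1 * dotc u u)) => N.
have -> : series (fun k => dotc (szego z u k) (szego z u k)) N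
    = (\sum_(k < N) (`|z| ^+ 2) ^+ k) * dotc u u.
  rewrite /series /= big_mkord mulr_suml; apply: eq_bigr => k _.
  by rewrite /szego dotcZl dotcZr mulrA -normCK normrX -!exprM mulnC.
apply: (ler_wpM2r (dotc_ge0 u)); apply: geom_sum_le; last by rewrite -subr_gt0.
exact: exprn_ge0.
Qed.

Lemma tail_szego (z : C) u : tail (szego z u) = z *: szego z u.
Proof. by apply/funext => k; rewrite /tail /szego exprS -scalerA. Qed.

Lemma hdot_szego (z : C) u : `|z| < 1 ->
  (1 - `|z| ^+ 2) * hdot (szego z u) (szego z u) = dotc u u.
Proof.
move=> z1; have lk := l2_szego (u := u) z1.
have := hdot_recl lk lk; rewrite tail_szego (hdotZl _ lk (l2_scale lk)) (hdotZr _ lk lk).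
rewrite /szego expr0 scale1r mulrA -normCK => e.
by rewrite mulrBl mul1r {1}e addrK.
Qed.

(** The kernels reproduce the values at z of the power series with
    coefficients in ell^2. *)
Lemma szego_coord (z : C) i y : `|z| < 1 -> l2 y ->
  series (fun k => z ^+ k * y k i 0) @ \oo --> hdot y (szego z^* (delta_mx i 0)).
Proof.
move=> z1 ly; have lk : l2 (szego z^* (delta_mx i 0)) by apply: l2_szego; rewrite norm_conjC.
apply: cvgn_ext (hdot_cvg ly lk) => N; apply: eq_bigr => k _.
by rewrite /szego dotcZr rmorphXn /= conjCK dotc_delta.
Qed.

(** For r = |z| > 0 the vector x + z y is the convex combination, with weights
    1 - r and r, of x / (1 - r) and (z / r) y. *)
Lemma convex_bound (z : C) x y : `|z| < 1 -> l2 x -> l2 y ->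
  (1 - `|z|) * hdot (x + z *: y) (x + z *: y)
  <= hdot x x + `|z| * (1 - `|z|) * hdot y y.
Proof.
move=> z1 lx ly.
have sq (a b : C) (lax := l2_scale (a := a) lx) (lby := l2_scale (a := b) ly) :
    hdot (a *: x + b *: y) (a *: x + b *: y)
    = a * a^* * hdot x x + a * b^* * hdot x y + b * a^* * hdot y x + b * b^* * hdot y y.
  have ls := l2_add lax lby.
  have hr (u : ell2 n) : l2 u -> hdot u (a *: x + b *: y) = a^* * hdot u x + b^* * hdot u y.
    by move=> lu; rewrite (hdotDr lax lby lu) (hdotZr _ lx lu) (hdotZr _ ly lu).
  rewrite (hdotDl lax lby ls) (hdotZl _ lx ls) (hdotZl _ ly ls) (hr x lx) (hr y ly).
  exact: bilinear_scalar.
have [->|z0] := eqVneq z 0.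
  by rewrite scale0r addr0 normr0 subr0 mul1r mul0r mul0r addr0.
have r0 : 0 < `|z| by rewrite normr_gt0.
set r := `|z| in r0 z1 *.
have rr : r^* = r by apply/CrealP; rewrite ger0_real // normr_ge0.
have lw := l2_add (l2_scale (a := r) lx) (l2_scale (a := - ((1 - r) * z)) ly).
have := hdot_ge0 lw.
have -> : x + z *: y = 1 *: x + z *: y by rewrite scale1r.
rewrite (sq r (- ((1 - r) * z))) (sq 1 z).
have -> : (- ((1 - r) * z))^* = - ((1 - r) * z^*).
  by rewrite conjCN rmorphM rmorphB /= conjC1 rr.
rewrite rr conjC1; apply: convex_scalar => //.
by rewrite -normCK expr2.
Qed.

(** Partial sums of the Neumann series of the inverse of I - z S'. *)
Definition neumann (z : C) y j : ell2 n := iter j (fun x => y + z *: tail x) 0.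

Lemma neumann_coord (z : C) y j k i :
  neumann z y j k i 0 = series (fun l => z ^+ l * y (k + l)%N i 0) j.
Proof.
elim: j k => [|j IH] k; first by rewrite /series /= big_geq // mxE.
rewrite series_recl expr0 mul1r addn0.
transitivity (y k i 0 + z * neumann z y j k.+1 i 0); first by rewrite /= !mxE.
rewrite IH /series /= mulr_sumr; congr (_ + _); apply: eq_bigr => l _.
by rewrite mulrA -exprS addSnnS.
Qed.

Lemma l2_neumann (z : C) y j : l2 y -> l2 (neumann z y j).
Proof.
move=> ly; elim: j => [|j IH]; first exact: l2_0.
exact: (l2_add ly (l2_scale (l2_tail IH))).
Qed.

Lemma hdot_tail_le x : l2 x -> hdot (tail x) (tail x) <= hdot x x.
Proof. by move=> lx; rewrite [leRHS](hdot_recl lx lx) lerDr dotc_ge0. Qed.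

Lemma neumann_bound (z : C) y j : `|z| < 1 -> l2 y ->
  (1 - `|z|) ^+ 2 * hdot (neumann z y j) (neumann z y j) <= hdot y y.
Proof.
move=> z1 ly; have r1 : 0 < 1 - `|z| by rewrite subr_gt0.
elim: j => [|j IH]; first by rewrite hdot0l mulr0 hdot_ge0.
set x := neumann z y j in IH *.
have lx : l2 x by exact: l2_neumann.
rewrite expr2 -mulrA.
apply: le_trans (_ : (1 - `|z|) * (hdot y y + `|z| * (1 - `|z|) * hdot x x) <= _).
  rewrite (ler_pM2l r1); apply: le_trans (convex_bound z1 ly (l2_tail lx)) _.
  rewrite lerD2l; apply: ler_wpM2l; last exact: hdot_tail_le.
  by apply: mulr_ge0; [exact: normr_ge0 | exact: ltW].
have -> : (1 - `|z|) * (hdot y y + `|z| * (1 - `|z|) * hdot x x)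
  = (1 - `|z|) * hdot y y + `|z| * ((1 - `|z|) ^+ 2 * hdot x x).
  by rewrite mulrDr expr2 !mulrA [(1 - _) * `|z|]mulrC.
apply: le_trans (_ : (1 - `|z|) * hdot y y + `|z| * hdot y y <= _).
  by rewrite lerD2l; apply: ler_wpM2l; [exact: normr_ge0 | exact: IH].
by rewrite -mulrDl subrK mul1r.
Qed.

(** The partial sums of the Neumann series converge in each coordinate and
    stay bounded by [neumann_bound], so their limit is in ell^2 and solves the
    equation.  A solution of x = z S' x vanishes because S' is a
    contraction. *)
Lemma resolvent (z : C) y : `|z| < 1 -> l2 y ->
  let x := hinv (fun x : ell2 n => x - z *: hadj S x) y in
  forall i, series (fun k => z ^+ k * y k i 0) @ \oo --> x 0%N i 0.
Proof.
move=> z1 ly x i.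
have ltl k : l2 (iter k tail y) by elim: k => [|k IH]; [exact: ly | exact: (l2_tail IH)].
have itE k l : iter k tail y l = y (k + l)%N.
  by elim: k l => [//|k IH] l; rewrite iterS /tail IH addSnnS.
pose x0 : ell2 n := fun k => \col_i limn (fun j => neumann z y j k i 0).
have cv k a : (fun j => neumann z y j k a 0) @ \oo --> x0 k a 0.
  have h := szego_coord (i := a) z1 (ltl k).
  have h' : (fun j => neumann z y j k a 0) @ \oo -->
      hdot (iter k tail y) (szego z^* (delta_mx a 0)).
    apply: cvgn_ext h => j; rewrite neumann_coord.
    by apply: eq_bigr => l _; rewrite itE.
  by rewrite mxE (cvgn_lim h').
have r1 : 0 < 1 - `|z| by rewrite subr_gt0.
have [lx0 _] : l2 x0 /\ hdot x0 x0 <= ((1 - `|z|) ^+ 2)^-1 * hdot y y.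
  apply: (l2_fatou (u := neumann z y) _ cv) => j; split; first exact: l2_neumann.
  by rewrite ler_pdivlMl ?exprn_gt0 //; exact: neumann_bound.
have eq0 : x0 = y + z *: tail x0.
  apply/funext => k; apply/matrixP => a b; rewrite ord1 {b}.
  have h1 := cvgn_shift 1 (cv k a).
  have h2 := cvgnD (cvgn_cst (a := y k a 0)) (cvgnZ (a := z) (cv k.+1 a)).
  rewrite [RHS](_ : _ = y k a 0 + z * x0 k.+1 a 0); last first.
    by rewrite -[LHS]/((y k + z *: x0 k.+1) a 0) [LHS]mxE [X in _ + X]mxE.
  refine (cvgn_unique (cvgn_ext _ h1) h2) => j.
  by rewrite addn1 -[LHS]/((y k + z *: neumann z y j k.+1) a 0) [LHS]mxE [X in _ + X]mxE.
have xx0 : x = x0.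
  rewrite /x /hinv; case: xgetP => [w _ [lw hw]|/(_ x0) []]; last first.
    split=> //; rewrite (hadj_shift lx0); apply/eqP; rewrite subr_eq; exact/eqP.
  have ew : w = y + z *: tail w by apply/eqP; rewrite -subr_eq -(hadj_shift lw); apply/eqP.
  have ld := l2_sub lw lx0; set d := w - x0 in ld.
  have ed : d = z *: tail d.
    rewrite {1}/d {1}ew {1}eq0 opprD addrACA subrr add0r -scalerBr.
    by [].
  apply: subr0_eq; apply: (hdot_eq0 ld); rewrite -/d.
  have /eqP : (1 - `|z| ^+ 2) * hdot d d = 0; last first.
    by rewrite mulf_eq0 gt_eqF ?norm_lt1_sqr //= => /eqP.
  apply: le_anti; rewrite mulr_ge0 ?hdot_ge0 // ?andbT; last by rewrite ltW ?norm_lt1_sqr.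
  have e : hdot d d = `|z| ^+ 2 * hdot (tail d) (tail d).
    rewrite {1 2}ed (hdotZl _ (l2_tail ld) (l2_scale (l2_tail ld))).
    by rewrite (hdotZr _ (l2_tail ld) (l2_tail ld)) mulrA normCK.
  by rewrite mulrBl mul1r {1}e -mulrBr mulr_ge0_le0 ?exprn_ge0 // subr_le0 hdot_tail_le.
rewrite xx0; apply: cvgn_ext (cv 0%N i) => j; rewrite neumann_coord.
exact: eq_bigr.
Qed.

End shift.

(** * Strictly positive operators are onto *)

Lemma linear_inj_surj (K : fieldType) (V : vectType K) (f : V -> V) :
  linear f -> (forall v, f v = 0 -> v = 0) -> forall w, exists v, f v = w.
Proof.
move=> lin inj w.
pose g : {linear V -> V} := HB.pack f (GRing.isLinear.Build _ _ _ _ f lin).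
have gE v : linfun g v = f v by rewrite lfunE.
have /lker0_limgf im : lker (linfun g) == 0%VS.
  rewrite -subv0; apply/subvP => v; rewrite memv_ker gE memv0 => /eqP/inj ->.
  by rewrite eqxx.
have /memv_imgP[v _ ->] : w \in limg (linfun g) by rewrite im memvf.
by exists v; rewrite gE.
Qed.

Section galerkin.
Context {R : realType}.
Local Notation C := (cplx R).
Variable n : nat.
Implicit Types (x y z : ell2 (R:=R) n).
Local Notation l2 := (hmem (ell2 (R:=R) n)).

Definition supp N x := forall k, (N <= k)%N -> x k = 0.

Lemma series_trunc (f : C^nat) N : (forall k, (N <= k)%N -> f k = 0) ->
  series f @ \oo --> series f N.
Proof.
move=> f0; apply: (@cvgn_eventually _ _ _ N) => M NM.
rewrite /series /= (big_cat_nat (n := N)) //= [X in _ + X]big_nat_cond.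
by rewrite [X in _ + X]big1 ?addr0 // => i /andP[/andP[/f0]].
Qed.

Lemma hdot_suppr N x z : supp N z -> hdot x z = series (fun k => dotc (x k) (z k)) N.
Proof.
by move=> zN; apply: hdot_eq; apply: series_trunc => k /zN ->; rewrite dotc0r.
Qed.

Lemma l2_supp N z : supp N z -> l2 z.
Proof.
move=> zN; apply: (@l2_bounded _ _ _ (series (fun k => dotc (z k) (z k)) N)).
apply: mono_le_lim; first exact: psum_mono.
by apply: series_trunc => k /zN ->; rewrite dotc0r.
Qed.

Lemma supp_leq N M x : (N <= M)%N -> supp N x -> supp M x.
Proof. by move=> NM xN k Mk; apply: xN; exact: leq_trans Mk. Qed.

Definition delta_seq k i : ell2 (R:=R) n := fun j => if j == k then delta_mx i 0 else 0.

Lemma supp_delta k i : supp k.+1 (delta_seq k i).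
Proof. by move=> j kj; rewrite /delta_seq gtn_eqF. Qed.

Lemma hdot_delta k i x : hdot x (delta_seq k i) = x k i 0.
Proof.
rewrite (hdot_suppr _ (@supp_delta k i)) /series /= big_nat_recr //= /delta_seq eqxx.
rewrite dotc_delta big_nat_cond big1 ?add0r // => j /andP[/andP[_ jk] _].
by rewrite ltn_eqF // dotc0r.
Qed.

(** The matrices of size n x N serve as the finite-dimensional space of
    sequences supported on [0, N). *)
Definition of_mx N (X : 'M[C]_(n, N)) : ell2 (R:=R) n :=
  fun k => if insub k is Some i then col i X else 0.

Definition to_mx N x : 'M[C]_(n, N) := \matrix_(i < n, k < N) x k i 0.

Lemma supp_of_mx N (X : 'M[C]_(n, N)) : supp N (of_mx X).
Proof. by move=> k Nk; rewrite /of_mx insubF // ltnNge Nk. Qed.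

Lemma of_mx_linear N (a : C) (X Y : 'M[C]_(n, N)) :
  of_mx (a *: X + Y) = a *: of_mx X + of_mx Y.
Proof.
apply/funext => k; rewrite -[RHS]/(a *: of_mx X k + of_mx Y k) /of_mx.
case: insubP => [i _ _|_]; last by rewrite scaler0 addr0.
by apply/matrixP => b c; rewrite !mxE.
Qed.

Lemma of_mxK N (X : 'M[C]_(n, N)) : to_mx N (of_mx X) = X.
Proof.
apply/matrixP => i k; rewrite mxE /of_mx.
case: insubP => [l _ e|]; last by rewrite ltn_ord.
by rewrite mxE; congr (X i _); apply/val_inj.
Qed.

Lemma hdot_to_mx N x x' z : supp N z -> to_mx N x = to_mx N x' -> hdot x z = hdot x' z.
Proof.
move=> zN e; rewrite !(hdot_suppr _ zN) /series /= !big_mkord; apply: eq_bigr => k _.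
congr dotc; apply/matrixP => i j; rewrite ord1.
by have /matrixP/(_ i k) := e; rewrite !mxE.
Qed.

Variable A : ell2 (R:=R) n -> ell2 (R:=R) n.
Hypothesis Apos : strictly_positive A.

Let lA x : l2 x -> l2 (A x).
Proof. by case: Apos => -[h _] _; exact: h. Qed.

Let symA x y : l2 x -> l2 y -> hdot (A x) y = hdot x (A y).
Proof. by case: Apos => -[_ h] _; exact: h. Qed.

Lemma selfadjoint_linear a x y : l2 x -> l2 y -> A (a *: x + y) = a *: A x + A y.
Proof.
move=> lx ly; have lax := l2_scale (a := a) lx; have ls := l2_add lax ly.
have laA := l2_scale (a := a) (lA lx).
apply: (hdot_inj (lA ls) (l2_add laA (lA ly))) => z lz.
rewrite -(symA lz ls) (hdotDr lax ly (lA lz)) (hdotZr _ lx (lA lz)).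
by rewrite (symA lz lx) (symA lz ly) (hdotDr laA (lA ly) lz) (hdotZr _ (lA lx) lz).
Qed.

Lemma selfadjointB x y : l2 x -> l2 y -> A (x - y) = A x - A y.
Proof.
move=> lx ly; have := selfadjoint_linear (-1) ly lx; rewrite !scaleN1r => e.
by rewrite addrC e addrC.
Qed.

Lemma strictly_positive_eq0 x : l2 x -> hdot (A x) x = 0 -> x = 0.
Proof.
move=> lx h0; apply: (hdot_eq0 lx); case: Apos => _ [d d0 /(_ x lx)].
rewrite h0 pmulr_rle0 // => h; apply: le_anti; rewrite h hdot_ge0 //.
Qed.

(** The compression of A to the sequences supported on [0, N) is injective,
    hence onto. *)
Lemma galerkin_step N y : exists x, supp N x /\
  forall z, supp N z -> hdot (A x) z = hdot y z.
Proof.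
have lmx (X : 'M[C]_(n, N)) := l2_supp (supp_of_mx X).
have [|X HX|X HX] := @linear_inj_surj _ _ (fun X : 'M[C]_(n, N) => to_mx N (A (of_mx X))) _ _ (to_mx N y).
- move=> a X Y; rewrite of_mx_linear (selfadjoint_linear _ (lmx X) (lmx Y)).
  by apply/matrixP => i k; rewrite !mxE.
- rewrite -[X]of_mxK (_ : of_mx X = 0) ; first by apply/matrixP => i j; rewrite !mxE.
  apply: (strictly_positive_eq0 (lmx X)).
  rewrite (hdot_to_mx (supp_of_mx X) (x' := 0)) ?hdot0l // HX.
  by apply/matrixP => i j; rewrite !mxE.
- exists (of_mx X); split; first exact: supp_of_mx.
  by move=> z zN; exact: (hdot_to_mx zN HX).
Qed.

(** Galerkin approximation.  The solutions x_N of the compressed equations have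
    increments orthogonal for the form <A x, x>, so <A (x_M - x_N), x_M - x_N>
    is the difference of the bounded increasing sequence <y, x_N>.  By strict
    positivity the x_N converge to some x in ell^2, and symmetry of A allows
    one to pass to the limit in <x_N, A z> = <y, z> for finitely supported
    z. *)
Theorem strictly_positive_surj y : l2 y -> exists2 x, l2 x & A x = y.
Proof.
move=> ly; have [xx hxx] := choice (fun N => galerkin_step N y).
have sx N : supp N (xx N) by case: (hxx N).
have gx N z : supp N z -> hdot (A (xx N)) z = hdot y z by case: (hxx N) => _; apply.
have lx N : l2 (xx N) := l2_supp (sx N).
have [d d0 dA] : exists2 d : C, 0 < d & forall x, l2 x -> d * hdot x x <= hdot (A x) x.
  by case: Apos.
have [c cd] : exists c : C^nat, forall N, hdot y (xx N) = c N by exists (fun N => hdot y (xx N)).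
have cE N : hdot (A (xx N)) (xx N) = c N by rewrite (gx N _ (sx N)) cd.
have c0 N : 0 <= c N.
  rewrite -cE; apply: le_trans (dA _ (lx N)).
  by apply: mulr_ge0; [exact: (ltW d0) | exact: (hdot_ge0 (lx N))].
have step N M : (N <= M)%N ->
    d * hdot (xx M - xx N) (xx M - xx N) <= c M - c N.
  move=> NM; have ld := l2_sub (lx M) (lx N).
  apply: le_trans (dA _ ld) _; rewrite le_eqVlt; apply/orP; left; apply/eqP.
  rewrite (selfadjointB (lx M) (lx N)) (hdotBl (lA (lx M)) (lA (lx N)) ld).
  rewrite (hdotBr (lx M) (lx N) (lA (lx M))) (hdotBr (lx M) (lx N) (lA (lx N))).
  rewrite !cE (gx M _ (supp_leq NM (sx N))) cd.
  have -> : hdot (A (xx N)) (xx M) = c N; last by rewrite (subrr (c N)) (subr0 (c M - c N)).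
  rewrite (symA (lx N) (lx M)) (hdot_conj (lA (lx M)) (lx N)).
  rewrite (gx M _ (supp_leq NM (sx N))) cd.
  by apply/CrealP; rewrite ger0_real.
have cS N : c N <= c N.+1.
  rewrite -subr_ge0; apply: le_trans (step _ _ (leqnSn N)).
  by apply: mulr_ge0; [exact: (ltW d0) | exact: (hdot_ge0 (l2_sub (lx N.+1) (lx N)))].
have cM N : c N <= d^-1 * hdot y y.
  rewrite ler_pdivlMl //.
  have [->|cn0] := eqVneq (c N) 0; first by rewrite mulr0 hdot_ge0.
  have cp : 0 < c N by rewrite lt_def cn0 c0.
  have CS := hdot_CS ly (lx N); rewrite cd (ger0_norm (c0 N)) in CS.
  rewrite -(ler_pM2r cp) -mulrA -(expr2 (c N)).
  apply: le_trans (_ : d * (hdot y y * hdot (xx N) (xx N)) <= _).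
    by rewrite (ler_pM2l d0).
  rewrite mulrCA; apply: ler_wpM2l; first exact: hdot_ge0.
  by rewrite -(cE N); exact: (dA _ (lx N)).
have /cvg_ex[l cl] := cvgn_bounded_mono c0 cS cM.
have cle N : c N <= l := mono_le_lim cS cl N.
have diff N M : (N <= M)%N ->
    hdot (xx M - xx N) (xx M - xx N) <= d^-1 * (l - c N).
  move=> NM; rewrite ler_pdivlMl //; apply: le_trans (step _ _ NM) _.
  by rewrite lerD2r.
have to0 : (fun N => d^-1 * (l - c N)) @ \oo --> (0 : C).
  have h := cvgnZ (a := d^-1) (cvgnB (cvgn_cst (a := l)) cl).
  by rewrite subrr mulr0 in h.
pose x : ell2 (R:=R) n := fun k => \col_i limn (fun N => xx N k i 0).
have xc k i : (fun N => xx N k i 0) @ \oo --> x k i 0.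
  suff /cvg_ex[a ha] : cvgn (fun N => xx N k i 0) by rewrite mxE (cvgn_lim ha).
  apply: cvgn_cauchy => e e0; have e20 : 0 < e ^+ 2 by rewrite exprn_gt0.
  move/cvgrPdist_le: to0 => /(_ _ e20)[N _ hN].
  exists N => M NM; rewrite -(@ler_pXn2r _ 2) ?nnegrE ?normr_ge0 ?(ltW e0) //.
  have := hN N (leqnn N); rewrite /= sub0r normrN ger0_norm; last first.
    by apply: mulr_ge0; [rewrite invr_ge0; exact: (ltW d0) | rewrite subr_ge0].
  move=> h; apply: le_trans h; apply: le_trans (diff _ _ NM).
  apply: le_trans (dotc_le_hdot k (l2_sub (lx M) (lx N))).
  have := le_dotc_coord ((xx M - xx N) k) i.
  by rewrite -[X in `|X| ^+ 2]/((xx M k - xx N k) i 0) mxE [X in _ + X]mxE.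
have xlim N : l2 (x - xx N) /\ hdot (x - xx N) (x - xx N) <= d^-1 * (l - c N).
  apply: (l2_fatou (u := fun j => xx (j + N)%N - xx N)) => [j|k i].
    split; [exact: (l2_sub (lx _) (lx _)) | exact: (diff _ _ (leq_addl j N))].
  have h := cvgnB (cvgn_shift N (xc k i)) (cvgn_cst (a := xx N k i 0)).
  rewrite -[X in _ --> X]/((x k - xx N k) i 0) mxE [X in _ + X]mxE.
  apply: cvgn_ext h => j.
  by rewrite -[RHS]/((xx (j + N)%N k - xx N k) i 0) [RHS]mxE [X in _ = _ + X]mxE.
have lxl : l2 x by rewrite -[x](subrK (xx 0%N)); exact: l2_add (xlim 0%N).1 (lx 0%N).
exists x => //; apply/funext => k; apply/matrixP => i j; rewrite ord1 {j}.
rewrite -!hdot_delta; set z := delta_seq k i.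
have lz : l2 z := l2_supp (@supp_delta k i).
have lAz := lA lz.
rewrite (symA lxl lz).
have h1 : (fun N => hdot (xx N) (A z)) @ \oo --> hdot x (A z).
  have h2 := cvgnZ (a := hdot (A z) (A z)) to0; rewrite mulr0 in h2.
  apply: (cvgn_sqr_squeeze _ h2) => N.
  rewrite -(hdotBl (lx N) lxl lAz).
  have lN := l2_sub (lx N) lxl.
  apply: le_trans (hdot_CS lN lAz) _; rewrite mulrC.
  apply: ler_wpM2l; first exact: hdot_ge0.
  rewrite -opprB (hdotNl (xlim N).1 (l2_opp (xlim N).1)) (hdotNr (xlim N).1 (xlim N).1) opprK.
  exact: (xlim N).2.
have h3 : (fun N => hdot (xx N) (A z)) @ \oo --> hdot y z.
  apply: (@cvgn_eventually _ _ _ k.+1) => N kN.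
  by rewrite -(symA (lx N) lz) gx //; exact: (supp_leq kN (@supp_delta k i)).
exact: (cvgn_unique h1 h3).
Qed.

End galerkin.

(** * Toeplitz operators and isometries generated by wandering vectors *)

Section toep.
Context {R : realType}.
Local Notation C := (cplx R).

Definition toep r s (a : nat -> 'M[C]_(r, s)) (x : ell2 (R:=R) s) : ell2 (R:=R) r :=
  fun i => \sum_(j < i.+1) a (i - j)%N *m x j.

(** The column sequence of v, that is, T E v when the coefficients a are those
    of the symbol of T. *)
Definition cols r s (a : nat -> 'M[C]_(r, s)) (v : 'cV[C]_s) : ell2 (R:=R) r :=
  fun n => a n *m v.

Lemma limn_series_trunc (f : C^nat) N : (forall k, (N <= k)%N -> f k = 0) ->
  limn (series f) = \sum_(k < N) f k.
Proof.
by move=> h; rewrite (cvgn_lim (series_trunc h)) /series /= big_mkord.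
Qed.

Lemma toeplitzE r s (F : C -> 'M[C]_(r, s)) : toeplitz F = toep (taylor F).
Proof.
apply/funext => x; apply/funext => i; apply/matrixP => k l; rewrite ord1 {l} mxE.
rewrite (@limn_series_trunc _ i.+1) => [|j ij].
  rewrite /toep summxE; apply: eq_bigr => j _.
  by rewrite -ltnS ltn_ord.
by rewrite leqNgt ij /= mul0mx mxE.
Qed.

Lemma hankel_emb r s (F : C -> 'M[C]_(r, s)) v :
  hankel F (@emb R s v) = cols (fun n => taylor F n.+1) v.
Proof.
apply/funext => i; apply/matrixP => k l; rewrite ord1 {l} mxE.
rewrite (@limn_series_trunc _ 1) => [|[//|j] _].
  by rewrite big_ord_recl big_ord0 addr0 /= addn0.
by rewrite /= mulmx0 mxE.
Qed.

Section toep_lemmas.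
Variables (r s : nat) (a : nat -> 'M[C]_(r, s)).
Implicit Types (x y : ell2 (R:=R) s).

Lemma toep_linear (c : C) x y : toep a (c *: x + y) = c *: toep a x + toep a y.
Proof.
apply/funext => i; rewrite -[RHS]/(c *: toep a x i + toep a y i) /toep.
rewrite scaler_sumr -big_split /=; apply: eq_bigr => j _.
by rewrite -[X in _ *m X]/(c *: x j + y j) mulmxDr scalemxAr.
Qed.

Lemma toep0 : toep a 0 = 0.
Proof. by apply/funext => i; rewrite /toep big1 // => j _; rewrite mulmx0. Qed.

Lemma toepD x y : toep a (x + y) = toep a x + toep a y.
Proof. by rewrite -[x]scale1r toep_linear !scale1r. Qed.

Lemma toepZ (c : C) x : toep a (c *: x) = c *: toep a x.
Proof. by rewrite -[c *: x]addr0 toep_linear toep0 addr0. Qed.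

Lemma toepB x y : toep a (x - y) = toep a x - toep a y.
Proof. by rewrite toepD -scaleN1r toepZ scaleN1r. Qed.

Lemma toep_shift x : toep a (block_shift x) = block_shift (toep a x).
Proof.
apply/funext => -[|i]; first by rewrite /toep big_ord1 mulmx0.
by rewrite /toep big_ord_recl /= mulmx0 add0r.
Qed.

Lemma toep_emb v : toep a (@emb R s v) = cols a v.
Proof.
apply/funext => i; rewrite /toep big_ord_recl /= subn0 big1 ?addr0 // => j _.
by rewrite mulmx0.
Qed.

Lemma toep_recl x : toep a x = cols a (x 0%N) + block_shift (toep a (tail x)).
Proof. by rewrite {1}[x]ell2_split toepD toep_shift toep_emb. Qed.

Lemma toep_local x y i : (forall j, (j <= i)%N -> x j = y j) -> toep a x i = toep a y i.
Proof. by move=> h; apply: eq_bigr => j _; rewrite h // -ltnS. Qed.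

Lemma toep_row0 x : toep a x 0%N = a 0%N *m x 0%N.
Proof. by rewrite /toep big_ord1. Qed.

Lemma cols_sum v : cols a v = \sum_j v j 0 *: cols a (delta_mx j 0).
Proof.
apply/funext => n; rewrite fct_sumE /cols {1}[v]matrix_sum_delta mulmx_sumr.
by apply: eq_bigr => j _; rewrite big_ord1 -scalemxAr.
Qed.

Lemma cols_ind (P : ell2 (R:=R) r -> Prop) v :
  P 0 -> (forall (c : C) (x y : ell2 r), P x -> P y -> P (c *: x + y)) ->
  (forall j, P (cols a (delta_mx j 0))) -> P (cols a v).
Proof.
move=> P0 PD Pj; rewrite cols_sum; elim/big_ind: _ => //.
- by move=> x y Px Py; rewrite -[x]scale1r; exact: PD.
- by move=> j _; rewrite -[_ *: _]addr0; exact: PD.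
Qed.

Lemma cols_l2 v : (forall j, hmem (ell2 r) (cols a (delta_mx j 0))) ->
  hmem (ell2 r) (cols a v).
Proof.
apply: cols_ind; first exact: l2_0.
by move=> c x y lx ly; exact: (l2_add (l2_scale lx) ly).
Qed.

End toep_lemmas.

Lemma block_shift_inj n : injective (@block_shift R n).
Proof. by move=> x y e; apply/funext => k; have := congr1 (fun f => f k.+1) e. Qed.

Lemma block_shift0 n : @block_shift R n 0 = 0.
Proof. by apply/funext => -[|k]. Qed.

End toep.

Section wandering.
Context {R : realType}.
Local Notation C := (cplx R).
Variables (m p k : nat) (g : nat -> 'M[C]_(m, p)) (th : nat -> 'M[C]_(p, k)).
Local Notation l2 := (hmem (ell2 (R:=R) _)).
Local Notation S := (block_shift).

Definition ker_toep (x : ell2 (R:=R) p) := l2 x /\ toep g x = 0.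
Local Notation K := ker_toep.

Lemma ker_linear c x y : K x -> K y -> K (c *: x + y).
Proof.
move=> [lx Tx] [ly Ty]; split; first exact: (l2_add (l2_scale lx) ly).
by rewrite toep_linear Tx Ty scaler0 addr0.
Qed.

Lemma ker0 : K 0.
Proof. by split; [exact: l2_0 | exact: toep0]. Qed.

Lemma kerB x y : K x -> K y -> K (x - y).
Proof.
by move=> Kx Ky; rewrite addrC -scaleN1r; exact: ker_linear.
Qed.

Lemma ker_shift x : K x -> K (S x).
Proof.
by move=> [lx Tx]; split; [exact: l2_shift | rewrite toep_shift Tx block_shift0].
Qed.

Lemma ker_tail x : K x -> x 0%N = 0 -> K (tail x) /\ x = S (tail x).
Proof.
move=> [lx Tx] x0; have e : x = S (tail x).
  by apply/funext => -[|j]; rewrite //= x0.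
split; last exact: e.
split; first exact: (l2_tail lx).
by apply: block_shift_inj; rewrite -toep_shift -e Tx block_shift0.
Qed.

Hypothesis thK : forall v, K (cols th v).
Hypothesis th_orth : forall v x, K x -> hdot (cols th v) (S x) = 0.
Hypothesis th_iso : forall v, hdot (cols th v) (cols th v) = dotc v v.
Hypothesis th_full : forall x, K x -> exists u, x 0%N = th 0%N *m u.

(** Pythagoras, since cols th v is orthogonal to the shift of the kernel. *)
Lemma wandering_step v y : K y ->
  K (cols th v + S y) /\ hdot (cols th v + S y) (cols th v + S y) = dotc v v + hdot y y.
Proof.
move=> Ky; have Kv := thK v; have KS := ker_shift Ky; split.
  by rewrite -[cols th v]scale1r; exact: ker_linear.
have [lv _] := Kv; have [lS _] := KS; have ls := l2_add lv lS.
rewrite (hdotDl lv lS ls) (hdotDr lv lS lv) (hdotDr lv lS lS).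
rewrite (hdot_conj lv lS) (th_orth v Ky) conjC0 addr0 add0r th_iso.
by rewrite (hdot_shift Ky.1 Ky.1).
Qed.

Lemma wandering_finite N x : supp N x ->
  K (toep th x) /\ hdot (toep th x) (toep th x) = hdot x x.
Proof.
elim: N x => [|N IH] x sx.
  have -> : x = 0 by apply/funext => j; exact: sx.
  by rewrite toep0 !hdot0l; split; first exact: ker0.
have st : supp N (tail x) by move=> j Nj; exact: sx.
have [Kt et] := IH _ st; have lx := l2_supp sx.
have [Kx ex] := wandering_step (x 0%N) Kt.
rewrite (toep_recl th x); split; first exact: Kx.
by rewrite ex et [RHS](hdot_recl lx lx).
Qed.

Definition cut N n (x : ell2 (R:=R) n) : ell2 (R:=R) n :=
  fun j => if (j < N)%N then x j else 0.

Lemma supp_cut N n (x : ell2 (R:=R) n) : supp N (cut N x).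
Proof. by move=> j Nj; rewrite /cut ltnNge Nj. Qed.

Lemma hdot_cut_le N n (x : ell2 (R:=R) n) : l2 x -> hdot (cut N x) (cut N x) <= hdot x x.
Proof.
move=> lx; apply: le_trans (psum_le N lx).
rewrite (hdot_suppr _ (@supp_cut N n x)) /series /= le_eqVlt; apply/orP; left.
by apply/eqP/eq_big_nat => j /andP[_ jN]; rewrite /cut jN.
Qed.

Lemma toep_cut r s (a : nat -> 'M[C]_(r, s)) N i x : (i < N)%N ->
  toep a (cut N x) i = toep a x i.
Proof.
by move=> iN; apply: toep_local => j ji; rewrite /cut (leq_ltn_trans ji iN).
Qed.

(** Each coordinate of a Toeplitz image depends on finitely many entries of x,
    so the finitely supported case passes to the limit by [l2_fatou]. *)
Lemma wandering_ker x : l2 x ->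
  K (toep th x) /\ hdot (toep th x) (toep th x) <= hdot x x.
Proof.
move=> lx.
have hN N := wandering_finite (@supp_cut N _ x).
have [ly hy] : l2 (toep th x) /\ hdot (toep th x) (toep th x) <= hdot x x.
  apply: (l2_fatou (u := fun N => toep th (cut N x))) => [N|i b].
    by case: (hN N) => -[lN _] eN; split; [exact: lN | rewrite eN; exact: hdot_cut_le].
  by apply: (@cvgn_eventually _ _ _ i.+1) => N iN; rewrite (toep_cut _ _ iN).
split; last exact: hy.
split; first exact: ly.
apply/funext => i; have [[_ T0] _] := hN i.+1.
apply: etrans (congr1 (fun f => f i) T0).
by apply: toep_local => j ji; rewrite toep_cut.
Qed.

(** Splitting off the wandering vectors of the first N entries of x shows that
    the norm of the image dominates every partial sum of the norm of x. *)
Lemma wandering_norm x : l2 x -> hdot (toep th x) (toep th x) = hdot x x.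
Proof.
move=> lx; apply: le_anti; rewrite (wandering_ker lx).2 /=.
apply: l2_norm_le => N; elim: N x lx => [|N IH] x lx.
  by rewrite /series /= (big_geq (leqnn 0)); exact: (hdot_ge0 (wandering_ker lx).1.1).
have lt := l2_tail lx; have [Kt _] := wandering_ker lt.
have [_ e] := wandering_step (x 0%N) Kt.
rewrite (toep_recl th x) e series_recl lerD2l; exact: IH.
Qed.

Theorem wandering_isometry : Defs.isometry (toep th).
Proof. by move=> x lx; split; [exact: (wandering_ker lx).1.1 | exact: wandering_norm]. Qed.

(** Wold decomposition: f in the kernel is a wandering vector plus the shift
    of another vector of the kernel; iterating produces the entries of u, whose
    norms are controlled by Pythagoras. *)
Lemma wandering_onto f : K f -> exists2 u, l2 u & toep th u = f.
Proof.
move=> Kf.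
have ex (x : ell2 (R:=R) p) : exists uy : 'cV[C]_k * ell2 (R:=R) p,
    K x -> K uy.2 /\ x = cols th uy.1 + S uy.2.
  have [Kx|nK] := pselect (K x); last by exists (0, x).
  have [u xu] := th_full Kx.
  have Kd := kerB Kx (thK u).
  have d0 : (x - cols th u) 0%N = 0.
    by rewrite -[LHS]/(x 0%N - th 0%N *m u) xu subrr.
  have [Kt e] := ker_tail Kd d0.
  by exists (u, tail (x - cols th u)) => _ /=; split; rewrite // -e addrC subrK.
have [step hstep] := choice ex.
pose fs n := iter n (fun x => (step x).2) f.
pose u : ell2 (R:=R) k := fun n => (step (fs n)).1.
have Kfs n : K (fs n).
  elim: n => [//|n IH]; rewrite /fs iterS -/(fs n); exact: (hstep _ IH).1.
have fsE n : fs n = cols th (u n) + S (fs n.+1).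
  by rewrite {1}((hstep _ (Kfs n)).2).
have nrm N : series (fun n => dotc (u n) (u n)) N + hdot (fs N) (fs N) = hdot f f.
  elim: N => [|N <-]; first by rewrite /series /= big_geq // add0r.
  rewrite /series /= big_nat_recr //= -addrA; congr (_ + _).
  by rewrite [in RHS]fsE (wandering_step (u N) (Kfs N.+1)).2.
have lu : l2 u.
  apply: (@l2_bounded _ _ _ (hdot f f)) => N.
  by rewrite -(nrm N) lerDl; exact: (hdot_ge0 (Kfs N).1).
exists u; first exact: lu.
have itE n j : iter n (@tail R k) u j = u (n + j)%N.
  by elim: n j => [//|n IH] j; rewrite iterS /tail IH addSnnS.
have coord i n : toep th (iter n (@tail R k) u) i = fs n i.
  elim: i n => [|i IH] n; rewrite toep_recl fsE itE addn0 //.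
  rewrite -[LHS]/(_ + toep th (iter n.+1 (@tail R k) u) i).
  by rewrite IH.
by apply/funext => i; exact: (coord i 0%N).
Qed.

End wandering.

(** * Pointwise bound and finite-dimensional lemmas *)

Section sup_bound.
Context {R : realType}.
Local Notation C := (cplx R).
Variables (p k : nat) (th : nat -> 'M[C]_(p, k)).

(** The Szego kernel x with parameter conj z satisfies S' x = (conj z) x, so its
    image y satisfies y = th e_j + (conj z) S y.  Evaluating at z gives
    t = (1 - |z|^2) y_i(z), and Cauchy-Schwarz against another Szego kernel,
    whose norm cancels the factor, bounds it by 1. *)
Lemma isometry_sup_le1 (z t : C) i j :
  Defs.isometry (toep th) -> `|z| < 1 ->
  series (fun n => th n i j * z ^+ n) @ \oo --> t -> `|t| <= 1.
Proof.
move=> iso z1 tE; have zc1 : `|z^*| < 1 by rewrite norm_conjC.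
have lx : hmem (ell2 k) (szego z^* (delta_mx j 0)) := l2_szego zc1.
have le : hmem (ell2 p) (szego z^* (delta_mx i 0)) := l2_szego zc1.
set x := szego z^* (delta_mx j 0) in lx *; set e := szego z^* (delta_mx i 0) in le *.
have [ly ny] := iso _ lx; set y := toep th x in ly ny *.
have yE : y = cols th (delta_mx j 0) + z^* *: block_shift y.
  rewrite {1}/y toep_recl {2}/x tail_szego toepZ -/x -/y.
  rewrite [x 0%N](_ : _ = delta_mx j 0); last by rewrite /x /szego expr0 scale1r.
  by congr (_ + _); apply/funext => -[|n]; rewrite //= -[RHS]/(z^* *: 0) scaler0.
have lS := l2_shift ly; have lzS := l2_scale (a := z^*) lS.
have lc : hmem (ell2 p) (cols th (delta_mx j 0)).
  have -> : cols th (delta_mx j 0) = y - z^* *: block_shift y by rewrite {1}yE addrK.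
  exact: l2_sub ly lzS.
have tdot : t = hdot (cols th (delta_mx j 0)) e.
  apply: cvgn_unique (szego_coord z1 lc); apply: cvgn_ext tE => n.
  apply: eq_bigr => l _; rewrite /cols mulrC; congr (_ * _).
  by rewrite -colE mxE.
have Se : hdot (block_shift y) e = z * hdot y e.
  rewrite (hdot_recl lS le) dotc0l add0r {1}/e tail_szego -/e.
  by rewrite (hdotZr _ le ly) conjCK.
have main : t = (1 - `|z| ^+ 2) * hdot y e.
  have := hdotDl lc lzS le; rewrite -yE (hdotZl _ lS le) Se -tdot => h.
  by rewrite mulrBl mul1r {1}h mulrA [z^* * z]mulrC -normCK addrK.
have ze : (1 - `|z| ^+ 2) * hdot e e = 1.
  have := hdot_szego (delta_mx i 0 : 'cV[C]_p) zc1; rewrite norm_conjC => ->.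
  by rewrite dotc_delta mxE !eqxx.
have zy : (1 - `|z| ^+ 2) * hdot y y = 1.
  have := hdot_szego (delta_mx j 0 : 'cV[C]_k) zc1; rewrite norm_conjC -/x -ny => ->.
  by rewrite dotc_delta mxE !eqxx.
have q0 := norm_lt1_sqr z1.
have h : `|t| ^+ 2 <= 1.
  rewrite main normrM exprMn (ger0_norm (ltW q0)).
  apply: le_trans (_ : (1 - `|z| ^+ 2) ^+ 2 * (hdot y y * hdot e e) <= _).
    by apply: ler_wpM2l; [exact: (exprn_ge0 _ (ltW q0)) | exact: hdot_CS].
  by rewrite expr2 mulrACA zy ze mulr1.
by rewrite -(@expr_le1 _ 2).
Qed.

End sup_bound.

Section finite_dimensional.
Context {R : realType}.
Local Notation C := (cplx R).

Lemma col_inj_row_free (K : fieldType) p k (A : 'M[K]_(p, k)) :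
  (forall v : 'cV_k, A *m v = 0 -> v = 0) -> row_free A^T.
Proof.
move=> inj; rewrite -kermx_eq0; apply/rowV0P => u /sub_kermxP uA.
by apply: trmx_inj; rewrite trmx0; apply: inj; rewrite -[A]trmxK -trmx_mul uA trmx0.
Qed.

Lemma gram_unit p k (A : 'M[C]_(p, k)) :
  (forall v : 'cV_k, A *m v = 0 -> v = 0) -> A^t* *m A \in unitmx.
Proof.
move=> inj; rewrite -unitmx_tr -row_free_unit; apply: col_inj_row_free => v h.
by apply/inj/dotc_eq0; rewrite dotc_mulmxl mulmxA h dotc0r.
Qed.

Lemma adjoint_onto p k (A : 'M[C]_(p, k)) :
  (forall v : 'cV_k, A *m v = 0 -> v = 0) ->
  forall u : 'cV_k, exists w, A^t* *m w = u.
Proof.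
move=> /gram_unit uA u; exists (A *m (invmx (A^t* *m A) *m u)).
by rewrite mulmxA mulKVmx.
Qed.

Lemma range_of_orth p k (A : 'M[C]_(p, k)) (x : 'cV[C]_p) :
  (forall v : 'cV_k, A *m v = 0 -> v = 0) ->
  (forall w : 'cV_p, A^t* *m w = 0 -> dotc x w = 0) ->
  exists u, x = A *m u.
Proof.
move=> /gram_unit uA h; exists (invmx (A^t* *m A) *m (A^t* *m x)).
set u := invmx _ *m _; apply/subr0_eq/dotc_eq0.
have r0 : A^t* *m (x - A *m u) = 0.
  by rewrite mulmxBr mulmxA /u mulKVmx // subrr.
set r := x - A *m u in r0 *.
by rewrite {1}/r dotcDl (h _ r0) add0r -mulmxN dotc_mulmxl r0 dotc0r.
Qed.

(** Rank-nullity for g, whose kernel is the range of the injective A. *)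
Lemma complement_dim (K : fieldType) m p k (g : 'M[K]_(m, p)) (A : 'M[K]_(p, k)) :
  (forall u, exists x : 'cV_p, g *m x = u) ->
  (forall v : 'cV_k, A *m v = 0 -> v = 0) ->
  (forall v : 'cV_k, g *m (A *m v) = 0) ->
  (forall x : 'cV_p, g *m x = 0 -> exists u, x = A *m u) ->
  (m <= p)%N /\ k = (p - m)%N.
Proof.
move=> onto inj gA ker.
have [X gX] := choice (fun j : 'I_m => onto (delta_mx j 0)).
have rg : \rank g = m.
  apply/eqP; rewrite -/(row_free g); apply/row_freeP.
  exists (\matrix_(i, j) X j i 0); apply/matrixP => i j.
  have /matrixP/(_ i 0) := gX j; rewrite !mxE andbT => <-.
  by apply: eq_bigr => l _; rewrite mxE.
split; first by rewrite -{1}rg rank_leq_col.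
have /eqP rA := col_inj_row_free inj.
rewrite -[LHS]rA -[m in RHS]rg -[\rank g]mxrank_tr -[(p - _)%N]mxrank_ker.
apply/eqmx_rank; apply/andP; split.
  apply/sub_kermxP; rewrite -trmx_mul; apply: trmx_inj; rewrite trmxK trmx0.
  apply/matrixP => i j; have := gA (delta_mx j 0).
  by rewrite mulmxA -colE => /matrixP/(_ i 0); rewrite [LHS]mxE => ->; rewrite !mxE.
apply/row_subP => i; set r := row i _.
have rg0 : r *m g^T = 0 by apply/sub_kermxP; exact: row_sub.
have [|u ru] := ker r^T; first by rewrite -[g]trmxK -trmx_mul rg0 trmx0.
by rewrite -[r]trmxK ru trmx_mul submxMl.
Qed.

End finite_dimensional.

(** * The inner function spanning the kernel *)

Section construction.
Context {R : realType}.
Local Notation C := (cplx R).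
Variables (m p k : nat) (G : C -> 'M[C]_(m, p)) (Theta0 : 'M[C]_(p, k)).
Hypothesis hG : Hinfty G.
Hypothesis hpos : strictly_positive (TTstar G).
Hypothesis hTheta0 : is_Theta0 G Theta0.

Let g := taylor G.
Let T : ell2 (R:=R) p -> ell2 (R:=R) m := toeplitz G.
Local Notation l2 := (hmem (ell2 (R:=R) _)).
Local Notation K := (ker_toep g).
Local Notation S := (block_shift).
Local Notation E := (emb).

Let TE : T = toep g. Proof. exact: toeplitzE. Qed.

Lemma taylor_cols_l2 v : l2 (cols g v).
Proof.
apply: cols_l2 => j.
have [B hB] := choice (fun i => Hinfty1_taylor (hG i j)).
apply: (@l2_bounded _ _ _ (\sum_i B i)) => N.
rewrite /series /=; under eq_bigr do rewrite dotc_norm.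
rewrite exchange_big /=; apply: ler_sum => i _; rewrite big_mkord.
apply: le_trans (hB i N); rewrite le_eqVlt; apply/orP; left; apply/eqP.
by apply: eq_bigr => n _; rewrite /cols -colE !mxE.
Qed.

(** [hadj] takes the value 0 where no adjoint vector exists; for nonzero y this
    would give T T' y = 0, against strict positivity. *)
Lemma hadjP y : l2 y -> l2 (hadj T y) /\
  forall u, l2 u -> hdot (T u) y = hdot u (hadj T y).
Proof.
move=> ly; have [y0|y0] := eqVneq (hdot y y) 0.
  rewrite (hdot_eq0 ly y0) /hadj; case: xgetP => [x _ //|/(_ 0) []].
  by split=> [|u lu]; [exact: l2_0 | rewrite !hdot0r].
have : hadj T y <> 0.
  move=> h0; case: hpos => _ [d d0 /(_ y ly)].
  rewrite /TTstar /= -/T h0 TE toep0 hdot0l pmulr_rle0 // => h.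
  by move/eqP: y0; apply; apply: le_anti; rewrite h hdot_ge0.
by rewrite /hadj; case: xgetP.
Qed.

Lemma hinvP y : l2 y -> let x := hinv (TTstar G) y in
  [/\ l2 x, l2 (hadj T x) & T (hadj T x) = y].
Proof.
move=> ly x; rewrite /x /hinv; case: xgetP => [w _ [lw ew]|].
  by split; [exact: lw | exact: (hadjP lw).1 | exact: ew].
have [w lw ew] := strictly_positive_surj hpos ly.
by move/(_ w) => [].
Qed.

Lemma ker_orth x y : K x -> l2 y -> hdot x (hadj T y) = 0.
Proof. by move=> [lx Tx] ly; rewrite -(hadjP ly).2 // TE Tx hdot0l. Qed.

(** The vector W v, where W = T' (T T')^-1 H E. *)
Definition W_col (v : 'cV[C]_p) : ell2 (R:=R) p :=
  hadj T (hinv (TTstar G) (hankel G (@emb R p v))).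

Definition W_coef n : 'M[C]_p := \matrix_(i, j) W_col (delta_mx j 0) n i 0.

Lemma cols_of_matrix r s (f : 'cV[C]_s -> ell2 (R:=R) r) j :
  cols (fun n => \matrix_(i, j) f (delta_mx j 0) n i 0) (delta_mx j 0) = f (delta_mx j 0).
Proof.
by apply/funext => n; rewrite /cols -colE; apply/matrixP => i l; rewrite !mxE ord1.
Qed.

Lemma l2_hankel v : l2 (hankel G (@emb R p v)).
Proof. by rewrite hankel_emb; exact: (l2_tail (taylor_cols_l2 (v := v))). Qed.

Lemma l2_W v : l2 (cols W_coef v).
Proof.
apply: cols_l2 => j; rewrite cols_of_matrix.
by have [_ h _] := hinvP (l2_hankel (v := (delta_mx j 0))).
Qed.

Lemma W_orth_ker x v : K x -> hdot x (cols W_coef v) = 0.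
Proof.
move=> Kx; have [] : l2 (cols W_coef v) /\ hdot x (cols W_coef v) = 0; last by [].
apply: (cols_ind (P := fun y => l2 y /\ hdot x y = 0)).
- by split; [exact: l2_0 | exact: hdot0r].
- move=> c y z [ly hy] [lz hz]; split; first exact: (l2_add (l2_scale ly) lz).
  by rewrite (hdotDr (l2_scale ly) lz Kx.1) (hdotZr _ ly Kx.1) hy hz mulr0 addr0.
- move=> j; rewrite cols_of_matrix; have [lx l h] := hinvP (l2_hankel (v := (delta_mx j 0))).
  by split; [exact: l | exact: (ker_orth Kx lx)].
Qed.

Lemma toep_W v : T (cols W_coef v) = cols (fun n => g n.+1) v.
Proof.
have comp u : toep g (cols W_coef u) = cols (fun n => \sum_(j < n.+1) g (n - j)%N *m W_coef j) u.
  apply/funext => n; rewrite /toep /cols mulmx_suml; apply: eq_bigr => j _.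
  by rewrite mulmxA.
rewrite TE comp; congr (cols _ v); apply/funext => n.
apply/matrixP => i j; have := comp (delta_mx j 0).
rewrite cols_of_matrix -TE; have [_ _ ->] := hinvP (l2_hankel (v := (delta_mx j 0))).
rewrite hankel_emb => e.
have := congr1 (fun f : nat -> 'cV[C]_m => f n i 0) e.
by rewrite /cols -!colE !mxE => ->.
Qed.

(** The Taylor coefficients of I - z E' (I - z S')^-1 W. *)
Definition Y_coef n : 'M[C]_p := if n is n'.+1 then - W_coef n' else 1%:M.

Lemma cols_Y v : cols Y_coef v = E v - S (cols W_coef v).
Proof.
apply/funext => -[|n].
  by rewrite -[RHS]/(v - 0) /cols mul1mx subr0.
by rewrite -[RHS]/(0 - W_coef n *m v) /cols mulNmx sub0r.
Qed.

Lemma l2_Y v : l2 (cols Y_coef v).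
Proof. rewrite cols_Y; exact: (l2_sub (l2_emb (u := v)) (l2_shift (l2_W (v := v)))). Qed.

(** T E v = E G_0 v + S H E v, and the second term is T S W v. *)
Lemma toep_Y v : T (cols Y_coef v) = E (g 0%N *m v).
Proof.
rewrite cols_Y TE toepB toep_emb toep_shift -TE toep_W.
apply/funext => -[|n]; first by rewrite -[LHS]/(g 0%N *m v - 0) subr0.
by rewrite -[LHS]/(g n.+1 *m v - g n.+1 *m v) subrr.
Qed.

(** The orthogonal projection of E v onto the kernel of T. *)
Definition P_col (v : 'cV[C]_p) : ell2 (R:=R) p :=
  E v - hadj T (hinv (TTstar G) (T (@emb R p v))).

Definition P_coef n : 'M[C]_p := \matrix_(i, j) P_col (delta_mx j 0) n i 0.

Lemma P_spec v : K (cols P_coef v) /\ forall x, K x -> hdot x (cols P_coef v) = dotc (x 0%N) v.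
Proof.
have lTE u : l2 (T (@emb R p u)) by rewrite TE toep_emb; exact: taylor_cols_l2.
have qK j : K (cols P_coef (delta_mx j 0)).
  rewrite cols_of_matrix; have [_ l h] := hinvP (lTE (delta_mx j 0)).
  split; first exact: (l2_sub (l2_emb (u := _)) l).
  by rewrite toepB -TE h subrr.
split.
  apply: (cols_ind (P := ker_toep g)); [exact: ker0 | exact: ker_linear | exact: qK].
move=> x Kx; pose d : nat -> 'M[C]_p := fun n => if n is 0%N then 1%:M else 0.
have dE u : cols d u = E u.
  by apply/funext => -[|n]; rewrite /cols /= ?mul1mx ?mul0mx.
rewrite -hdot_embr -dE.
rewrite (cols_sum P_coef v) (cols_sum d v).
have lQ j : l2 (cols P_coef (delta_mx j 0)) := (qK j).1.
have ld j : l2 (cols d (delta_mx j 0)) by rewrite dE; exact: l2_emb.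
suff [_ [_ ->]] : l2 (\sum_j v j 0 *: cols P_coef (delta_mx j 0)) /\
    l2 (\sum_j v j 0 *: cols d (delta_mx j 0)) /\
    hdot x (\sum_j v j 0 *: cols P_coef (delta_mx j 0))
    = hdot x (\sum_j v j 0 *: cols d (delta_mx j 0)) by [].
elim/big_ind2: _.
- by split; [exact: l2_0 | split; [exact: l2_0|]].
- move=> a1 a2 b1 b2 [la1 [la2 ea]] [lb1 [lb2 eb]].
  split; first exact: (l2_add la1 lb1).
  split; first exact: (l2_add la2 lb2).
  by rewrite (hdotDr la1 lb1 Kx.1) (hdotDr la2 lb2 Kx.1) ea eb.
- move=> j _; split; first exact: (l2_scale (lQ j)).
  split; first exact: (l2_scale (ld j)).
  rewrite (hdotZr _ (lQ j) Kx.1) (hdotZr _ (ld j) Kx.1).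
  have -> : hdot x (cols P_coef (delta_mx j 0)) = hdot x (cols d (delta_mx j 0)); last by [].
  rewrite cols_of_matrix dE /P_col; have [lx l h] := hinvP (lTE (delta_mx j 0)).
  by rewrite (hdotBr (l2_emb (u := _)) l Kx.1) (ker_orth Kx lx) subr0.
Qed.

Lemma P_coef0 : P_coef 0%N = Theta0_gram G.
Proof.
apply/matrixP => i j; rewrite /Theta0_gram !mxE /= hadj_emb -/T.
by rewrite andbT.
Qed.

Let ThetaE : Theta0 *m Theta0^t* = P_coef 0%N. Proof. by rewrite P_coef0; case: hTheta0. Qed.
Let Theta0_inj (v : 'cV_k) : Theta0 *m v = 0 -> v = 0. Proof. by case: hTheta0 => _; apply. Qed.

Definition Theta_coef n : 'M[C]_(p, k) := Y_coef n *m Theta0.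

Lemma cols_Theta v : cols Theta_coef v = cols Y_coef (Theta0 *m v).
Proof. by apply/funext => n; rewrite /cols /Theta_coef mulmxA. Qed.

Lemma g0_Theta0 (v : 'cV_k) : g 0%N *m (Theta0 *m v) = 0.
Proof.
have [w <-] := adjoint_onto Theta0_inj v.
rewrite (mulmxA Theta0) ThetaE.
have [[_ Tq] _] := P_spec w.
by have := congr1 (fun f => f 0%N) Tq; rewrite toep_row0.
Qed.

Lemma Theta_ker v : K (cols Theta_coef v).
Proof.
rewrite cols_Theta; split; first exact: l2_Y.
by rewrite -TE toep_Y g0_Theta0; apply/funext => -[|n].
Qed.

Lemma Theta_orth_shift v x : K x -> hdot (cols Theta_coef v) (S x) = 0.
Proof.
move=> Kx; rewrite cols_Theta cols_Y; set u := Theta0 *m v.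
have lS := l2_shift Kx.1; have lW := l2_W (v := u).
rewrite (hdotBl (l2_emb (u := u)) (l2_shift lW) lS) hdot_embl dotc0r sub0r.
by rewrite (hdot_shift lW Kx.1) (hdot_conj Kx.1 lW) (W_orth_ker u Kx) conjC0 oppr0.
Qed.

(** The difference d lies in the kernel and has first coordinate 0, so it is in
    the shift of the kernel, to which both terms are orthogonal. *)
Lemma Theta_adjoint_P w : cols Theta_coef (Theta0^t* *m w) = cols P_coef w.
Proof.
have Kt := Theta_ker (Theta0^t* *m w); have [KQ hQ] := P_spec w.
have Kd := kerB Kt KQ; set d := _ - _ in Kd.
have d0 : d 0%N = 0.
  rewrite /d -[LHS]/(Theta_coef 0%N *m (Theta0^t* *m w) - P_coef 0%N *m w).
  by rewrite mulmxA /Theta_coef /= mul1mx ThetaE subrr.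
have [Kt' dS] := ker_tail Kd d0.
apply: subr0_eq; rewrite -/d; apply: (hdot_eq0 Kd.1).
rewrite {1}/d (hdotBl Kt.1 KQ.1 Kd.1) (hdot_conj Kd.1 KQ.1) (hQ _ Kd) d0 dotc0l conjC0 subr0.
by rewrite dS; exact: Theta_orth_shift.
Qed.

Lemma Theta_dot u x : K x ->
  exists2 w, Theta0^t* *m w = u & hdot x (cols Theta_coef u) = dotc (x 0%N) w.
Proof.
move=> Kx; have [w wu] := adjoint_onto Theta0_inj u; exists w; first exact: wu.
by rewrite -wu Theta_adjoint_P; exact: (P_spec w).2.
Qed.

Lemma Theta_isometric v : hdot (cols Theta_coef v) (cols Theta_coef v) = dotc v v.
Proof.
have [w wv ->] := Theta_dot v (Theta_ker v).
by rewrite /cols /Theta_coef /= mul1mx dotc_mulmxl wv.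
Qed.

(** If Theta0^* w = 0 then P E w = 0, so that <x_0, w> = <x, P E w> = 0 for x in
    the kernel. *)
Lemma Theta_full x : K x -> exists u, x 0%N = Theta_coef 0%N *m u.
Proof.
move=> Kx; have [|u xu] := range_of_orth (x := x 0%N) Theta0_inj.
  move=> w w0; rewrite -((P_spec w).2 _ Kx) -Theta_adjoint_P w0.
  rewrite [cols Theta_coef 0](_ : _ = 0) ?hdot0r //.
  by apply/funext => n; rewrite /cols mulmx0.
by exists u; rewrite /Theta_coef /= mul1mx.
Qed.

Lemma g0_onto u : exists x : 'cV[C]_p, g 0%N *m x = u.
Proof.
have [_ l h] := hinvP (l2_emb (u := u)); set y := hadj T _ in l h.
exists (y 0%N); rewrite -toep_row0 -TE h //.
Qed.

(** By [toep_Y], x is the first coordinate of a vector in the kernel of T. *)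
Lemma g0_ker (x : 'cV_p) : g 0%N *m x = 0 -> exists u, x = Theta0 *m u.
Proof.
move=> gx; have KY : K (cols Y_coef x).
  split; first exact: l2_Y.
  by rewrite -TE toep_Y gx; apply/funext => -[|n].
have [u e] := Theta_full KY; exists u.
by move: e; rewrite /cols /Theta_coef /= !mul1mx.
Qed.

Lemma Yfun_expansion i j (z : C) : `|z| < 1 ->
  series (fun n => Y_coef n i j * z ^+ n) @ \oo --> Yfun G z i j.
Proof.
move=> z1; have [_ l _] := hinvP (l2_hankel (v := (delta_mx j 0))).
have h := @resolvent _ _ z _ z1 l i.
have h2 := cvgnB (cvgn_cst (a := (1%:M : 'M[C]_p) i j)) (cvgnZ (a := z) h).
rewrite /Yfun !mxE /= hadj_emb; rewrite [X in X - _]mxE in h2.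
apply: (@cvgn_shiftP _ _ _ 1); apply: cvgn_ext h2 => N.
rewrite addn1 series_recl expr0 mulr1 mxE; congr (_ + _).
rewrite /series /= mulr_sumr -sumrN; apply: eq_bigr => n _.
by rewrite !mxE mulNr exprS; congr (- _); rewrite mulrA mulrC.
Qed.

Lemma Theta_expansion i j :
  disc_expansion (fun z => (Yfun G z *m Theta0) i j) (fun n => Theta_coef n i j).
Proof.
move=> z z1; rewrite mxE.
have h := @cvgn_sum R _ (index_enum 'I_p) predT
  (fun l N => series (fun n => Y_coef n i l * z ^+ n) N * Theta0 l j)
  (fun l => Yfun G z i l * Theta0 l j).
apply: cvgn_ext (h _) => [N|l].
  rewrite /series /=; under eq_bigr do rewrite mulr_suml.
  rewrite exchange_big /=; apply: eq_bigr => n _.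
  by rewrite /Theta_coef mxE mulr_suml; apply: eq_bigr => l _; rewrite mulrAC.
exact: cvgnM (Yfun_expansion (i := i) (j := l) z1) (cvgn_cst (a := Theta0 l j)).
Qed.

End construction.

Theorem proposition2p5 (R : realType) (m p k : nat)
    (G : cplx R -> 'M[cplx R]_(m, p)) (Theta0 : 'M[cplx R]_(p, k))
    (hG : Hinfty G) (hpos : strictly_positive (TTstar G))
    (hTheta0 : is_Theta0 G Theta0) :
  let Theta : cplx R -> 'M[cplx R]_(p, k) := fun z => Yfun G z *m Theta0 in
  (m <= p)%N /\ k = (p - m)%N /\
  Hinfty Theta /\ inner Theta /\
  hIm (toeplitz Theta) = hKer (toeplitz G).
Proof.
move=> Theta.
have ThK := Theta_ker hG hpos hTheta0; have ThO := Theta_orth_shift Theta0 hG hpos.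
have ThI := Theta_isometric hG hpos hTheta0; have ThF := Theta_full hG hpos hTheta0.
have TTh : toeplitz Theta = toep (Theta_coef G Theta0).
  rewrite toeplitzE; congr toep; apply/funext => n; apply/matrixP => i j.
  by rewrite mxE (taylor1E (Theta_expansion hG hpos (Theta0 := Theta0) (i := i) (j := j))).
have iso : Defs.isometry (toep (Theta_coef G Theta0)) := wandering_isometry ThK ThO ThI.
have HTh : Hinfty Theta.
  move=> i j; split.
    by exists (fun n => Theta_coef G Theta0 n i j) => z z1; exact: (Theta_expansion hG hpos z1).
  exists 1 => z z1; apply: (isometry_sup_le1 iso z1).
  exact: (Theta_expansion hG hpos z1).
have [mp kE] := complement_dim (g0_onto hpos) (fun v => hTheta0.2 v)
  (g0_Theta0 hG hpos hTheta0) (g0_ker hG hpos hTheta0).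
split; first exact: mp.
split; first exact: kE.
split; first exact: HTh.
split; first by split; [exact: HTh | rewrite TTh; exact: iso].
rewrite TTh toeplitzE; apply/seteqP; split => [_ [u lu <-]|f Kf].
  exact: (wandering_ker ThK ThO ThI lu).1.
have [u lu uf] := wandering_onto ThK ThO ThI ThF Kf.
by exists u.
Qed.
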